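(* Let $N\in\{2,3\}$ and let $K$ be a compact set in $\mathbb{R}^{N}$. Let $\mathcal{V}$ and $\Omega$ be two bounded open sets in $\mathbb{R}^N$ such that $K \subset \mathcal{V}$, $\overline{\mathcal{V}} \subset \Omega$, and each connected component of $\mathbb{R}^{N} \setminus K$ contains an interior point of $\mathbb{R}^{N} \setminus \Omega$. Then for any $(u,p) \in C^{\infty}(\mathcal{V};\mathbb{R}^{N+1})$ solving the Stokes equation in $\mathcal{V}$, \[ -\Delta u + \nabla p = 0, \qquad \operatorname{div} u = 0 \quad\text{in } \mathcal{V}, \] for any $k \in \mathbb{N}$ and any $\varepsilon>0$ there exists $(\overline{u},\overline{p}) \in C_{c}^{\infty}(\mathbb{R}^{N}; \mathbb{R}^{N+1})$ solving the Stokes equation in $\Omega$, \[ -\Delta \overline{u} + \nabla \overline{p} = 0, \qquad \operatorname{div} \overline{u} = 0 \quad\text{in } \Omega, \] and such that \[ \| \overline{u} - u \|_{C^{k}(K)} \leq \varepsilon. \] *)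

(* Defs.v *)
From HB Require Import structures.
From mathcomp Require Import all_boot all_order all_algebra.
From mathcomp Require Import all_classical all_reals all_analysis.
Set Implicit Arguments. Unset Strict Implicit. Unset Printing Implicit Defensive.
Import Order.TTheory GRing.Theory Num.Theory.
Import numFieldNormedType.Exports.
Local Open Scope classical_set_scope.
Local Open Scope ring_scope.

Section Defs.
Variables (R : realType) (N : nat).

Definition ebasis (i : 'I_N) : 'rV[R]_N := delta_mx 0 i.

Fixpoint dpart (s : seq 'I_N) (f : 'rV[R]_N -> R) : 'rV[R]_N -> R :=
  match s with
  | [::] => f
  | i :: s' => fun x => 'D_(ebasis i) (dpart s' f) x
  end.

Definition smooth_on (U : set 'rV[R]_N) (f : 'rV[R]_N -> R) : Prop :=
  forall s : seq 'I_N, forall x, U x ->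
    {for x, continuous (dpart s f)} /\
    forall i : 'I_N, derivable (dpart s f) x (ebasis i).

Definition laplacian (f : 'rV[R]_N -> R) : 'rV[R]_N -> R :=
  fun x => \sum_(i < N) dpart [:: i; i] f x.

Definition stokes_on (U : set 'rV[R]_N) (u : 'rV[R]_N -> 'rV[R]_N)
  (p : 'rV[R]_N -> R) : Prop :=
  (forall x, U x -> forall j : 'I_N,
      - laplacian (fun y => u y 0 j) x + dpart [:: j] p x = 0) /\
  (forall x, U x -> \sum_(j < N) dpart [:: j] (fun y => u y 0 j) x = 0).

Definition smooth_pair_on (U : set 'rV[R]_N) (u : 'rV[R]_N -> 'rV[R]_N)
  (p : 'rV[R]_N -> R) : Prop :=
  (forall j : 'I_N, smooth_on U (fun y => u y 0 j)) /\ smooth_on U p.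

Definition Ck_le (k : nat) (K : set 'rV[R]_N) (w : 'rV[R]_N -> 'rV[R]_N)
  (eps : R) : Prop :=
  forall s : seq 'I_N, (size s <= k)%N -> forall j : 'I_N, forall x, K x ->
    `| dpart s (fun y => w y 0 j) x | <= eps.

End Defs.

(* Main.v *)
Require Import Defs.
From HB Require Import structures.
From mathcomp Require Import all_boot all_order all_algebra.
From mathcomp Require Import all_classical all_reals all_analysis.
From mathcomp Require Import finmap ring lra.
Import Order.TTheory GRing.Theory Num.Theory.
Import numFieldNormedType.Exports.
Local Open Scope classical_set_scope.
Local Open Scope ring_scope.
Set Implicit Arguments. Unset Strict Implicit. Unset Printing Implicit Defensive.

(** Away from its pole, a column of the Stokes fundamental solution is built from
   derivatives of a biharmonic kernel Phi: Phi = |x| in dimension 3 and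
   |x|^2 ln |x|^2 in dimension 2, up to a constant.

   Pole pushing: let Z be the set of z outside K such that every Stokes field
   with its only pole at z, obtained from such kernels, is a C^k(K) limit of
   admissible fields. Exterior points of Omega are in Z, by multiplication with a
   cut-off that vanishes near the pole. Expanding in a Taylor series with respect
   to the pole, with a radius that depends only on the distance to K, shows that
   Z is open and closed in the complement of K, hence is all of it.

   Representation: cut (u, p) off to (U, P), compactly supported in V. The
   defects f = - Delta U + grad P and g = div U vanish near K, and U is the
   convolution of (f, g) with the kernels. Integrals are replaced by lattice sums,
   which are finite combinations of fields with poles off K. With |x|^2 + d^2 in
   place of |x|^2 the kernels are smooth, summation by parts is exact up to
   O_d(mesh), and Delta^2 Phi_d is a multiple of the positive approximate identity
   d^4 (|x|^2 + d^2)^(-(N+4)/2); first the mesh and then d tend to 0. *)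

(** * Smooth functions *)

(** The representation has to reconcile two families of kernels. The singular ones (d = 0) solve the
    Stokes system off their pole but cannot be summed by parts over lattice points close to x; the
    regularized ones can, but do not solve the system. The defects f and g vanish near K, so on K
    the passage from one family to the other costs only O(d), while the identities for the cut-off
    field are all proved for d > 0.

    The mass of the approximate identity on the lattice is never computed. It is shown to be nearly
    independent of the point x, and bounded below by a positive constant as soon as d = 1/p and the
    mesh is 1/(pq); the approximant is divided by it. The total error has the form A d + D / n with
    A independent of d, which is why p is chosen before q.

    Kernels are given by a syntax, so that algebraic identities, factorial growth of derivatives and
    the limit d -> 0 are all inductions on expressions. *)

Section DirectionalDerivatives.
Variables (R : realType) (V : normedModType R).
Implicit Types (x v : V) (f g : V -> R).

(** Restriction to a line makes the one-variable chain rule available for directional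
    derivatives. *)
Lemma is_derive_line f x v (df : R) :
  is_derive x v f df <-> is_derive (0 : R) 1 (fun h : R => f (h *: v + x)) df.
Proof.
have E : 'D_v f x = 'D_1 (fun h : R => f (h *: v + x)) 0.
  rewrite /derive; set g1 := fun h => h^-1 *: _; set g2 := fun h => h^-1 *: _.
  suff -> : g1 = g2 by [].
  by apply/funext => h; rewrite /g1 /g2 /= addr0 scale0r add0r [_%:A]mulr1.
split=> -[d e]; split.
- by move/derivable1P: d.
- by rewrite -E.
- by apply/(derivable1P f x v).
- by rewrite E.
Qed.

Lemma is_derive_comp1 f (g : R -> R) x v (df dg : R) :
  is_derive x v f df -> is_derive (f x) 1 g dg ->
  is_derive x v (fun y => g (f y)) (dg * df).
Proof.
move=> /is_derive_line hf hg; apply/is_derive_line.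
have hg' : is_derive ((fun h : R => f (h *: v + x)) 0) 1 g dg.
  by rewrite scale0r add0r.
exact: (@is_derive1_comp _ g (fun h : R => f (h *: v + x)) 0 dg df hg' hf).
Qed.

Lemma is_derive_add f g x v (df dg : R) :
  is_derive x v f df -> is_derive x v g dg ->
  is_derive x v (fun y => f y + g y) (df + dg).
Proof. by move=> hf hg; exact: is_deriveD. Qed.

Lemma is_derive_mul f g x v (df dg : R) :
  is_derive x v f df -> is_derive x v g dg ->
  is_derive x v (fun y => f y * g y) (df * g x + f x * dg).
Proof.
move=> hf hg; apply: (is_derive_eq (is_deriveM hf hg)).
by rewrite addrC; congr (_ + _); exact: mulrC.
Qed.

Lemma is_derive_fsum (I : Type) (r : seq I) (F dF : I -> V -> R) x v :
  (forall i, is_derive x v (F i) (dF i x)) ->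
  is_derive x v (fun y => \sum_(i <- r) F i y) (\sum_(i <- r) dF i x).
Proof.
move=> h; elim: r => [|i r IH].
  by rewrite big_nil; under eq_fun do rewrite big_nil; exact: is_derive_cst.
by rewrite big_cons; under eq_fun do rewrite big_cons; exact: is_derive_add.
Qed.

End DirectionalDerivatives.

Section Smooth.
Variables (R : realType) (N : nat).
Implicit Types (x v : 'rV[R]_N) (f g : 'rV[R]_N -> R) (U : set 'rV[R]_N).
Implicit Type Fam : ('rV[R]_N -> R) -> Prop.

(** An invariant that replaces explicit formulas for iterated derivatives: on U, each partial
    derivative of a member agrees with some member. Membership then implies [smooth_on U]. *)
Definition derivation_closed U Fam := 
  (forall f, Fam f -> forall x, U x -> {for x, continuous f}) /\
  (forall f, Fam f -> forall i, exists2 g, Fam g &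
     forall x, U x -> is_derive x (ebasis R i) f (g x)).

Lemma dpart_near U f g (s : seq 'I_N) : open U -> (forall x, U x -> f x = g x) ->
  forall x, U x -> dpart s f x = dpart s g x.
Proof.
move=> oU fg; elim: s => [|i s IH] x Ux //=; first exact: fg.
apply: near_eq_derive; near do apply: IH.
exact: open_nbhs_nbhs.
Unshelve. all: by end_near. Qed.

Lemma dpart_family U Fam : open U -> derivation_closed U Fam ->
  forall f s, Fam f -> exists2 g, Fam g & forall x, U x -> dpart s f x = g x.
Proof.
move=> oU [cF dF] f; elim=> [|i s IH] Ff; first by exists f.
have [g Fg fg] := IH Ff; have [h Fh gh] := dF _ Fg i.
exists h => // x Ux /=.
have <- : 'D_(ebasis R i) g x = h x by have [_ ->] := gh _ Ux.
by apply: near_eq_derive; near do apply: fg; exact: open_nbhs_nbhs.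
Unshelve. all: by end_near. Qed.

Lemma smooth_onP U f (s : seq 'I_N) i x : smooth_on U f -> U x ->
  is_derive x (ebasis R i) (dpart s f) (dpart (i :: s) f x).
Proof. by move=> sf Ux; have [_ /(_ i)] := sf s x Ux; apply: derivableP. Qed.

Lemma smooth_on_family U Fam f : open U -> derivation_closed U Fam -> Fam f ->
  smooth_on U f.
Proof.
move=> oU HF Ff s x Ux; have [g Fg fg] := @dpart_family U Fam oU HF f s Ff.
have nfg : \near x, g x = dpart s f x.
  by near do (apply/esym; apply: fg); exact: open_nbhs_nbhs.
split; first last.
  move=> i; have [h _ /(_ x Ux) [gd _]] := (proj2 HF) _ Fg i.
  exact: near_eq_derivable gd.
have gx := (proj1 HF) _ Fg _ Ux.
rewrite /prop_for /continuous_at (fg _ Ux).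
by apply: cvg_trans gx; apply: (near_eq_cvg nfg).
Unshelve. all: by end_near. Qed.

Lemma smooth_on_near U f g : open U -> (forall x, U x -> f x = g x) ->
  smooth_on U f -> smooth_on U g.
Proof.
move=> oU fg sf.
apply: (@smooth_on_family _ (fun h => exists s, forall x, U x -> dpart s f x = h x)) => //.
- split=> [h [s e] x Ux|h [s e] i].
  + have [c _] := sf s x Ux; rewrite /prop_for /continuous_at -(e _ Ux).
    have nfg : \near x, dpart s f x = h x by near do apply: e; exact: open_nbhs_nbhs.
    by apply: cvg_trans c; apply: (near_eq_cvg nfg).
  + exists (dpart (i :: s) f); first by exists (i :: s).
    move=> x Ux; apply: near_eq_is_derive (smooth_onP s i sf Ux).
    by near do apply: e; exact: open_nbhs_nbhs.
- by exists [::].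
Unshelve. all: by end_near. Qed.

Lemma smooth_on_dpart U f (s : seq 'I_N) : smooth_on U f -> smooth_on U (dpart s f).
Proof.
move=> sf t x Ux; have := sf (t ++ s) x Ux.
suff -> : dpart (t ++ s) f = dpart t (dpart s f) by [].
by elim: t => //= i t ->.
Qed.

Inductive alg_closure (G : ('rV[R]_N -> R) -> Prop) : ('rV[R]_N -> R) -> Prop :=
| alg_gen f : G f -> alg_closure G f
| alg_add f g : alg_closure G f -> alg_closure G g -> alg_closure G (fun x => f x + g x)
| alg_mul f g : alg_closure G f -> alg_closure G g -> alg_closure G (fun x => f x * g x).

(** Sums and products are stable under the Leibniz rule, so only the derivatives of the generators
    have to be found, and these may lie anywhere in the generated algebra. *)
Lemma smooth_on_alg U (G : ('rV[R]_N -> R) -> Prop) :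
  open U ->
  (forall f, G f -> forall x, U x -> {for x, continuous f}) ->
  (forall f, G f -> forall i, exists2 g, alg_closure G g &
     forall x, U x -> is_derive x (ebasis R i) f (g x)) ->
  forall f, alg_closure G f -> smooth_on U f.
Proof.
move=> oU cG dG f Gf; apply: (smooth_on_family oU _ Gf); split => {f Gf}.
- move=> f; elim=> {f} [f Gf x Ux|f g _ IHf _ IHg x Ux|f g _ IHf _ IHg x Ux].
  + exact: cG.
  + by apply: continuousD; [exact: IHf|exact: IHg].
  + by apply: continuousM; [exact: IHf|exact: IHg].
- move=> f; elim=> {f} [f Gf i|f g Gf IHf Gg IHg i|f g Gf IHf Gg IHg i].
  + exact: dG.
  + have [f' Gf' df] := IHf i; have [g' Gg' dg] := IHg i.
    exists (fun x => f' x + g' x); first exact: alg_add.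
    by move=> x Ux; apply: is_derive_add; [exact: df|exact: dg].
  + have [f' Gf' df] := IHf i; have [g' Gg' dg] := IHg i.
    exists (fun x => f' x * g x + f x * g' x).
      by apply: alg_add; apply: alg_mul.
    by move=> x Ux; apply: is_derive_mul; [exact: df|exact: dg].
Qed.

Lemma smooth_on_gen2 U f g : open U -> smooth_on U f -> smooth_on U g ->
  forall h, alg_closure (fun k => exists s, k = dpart s f \/ k = dpart s g) h ->
  smooth_on U h.
Proof.
move=> oU sf sg; apply: smooth_on_alg => //.
- by move=> _ [s [->|->]] x Ux; [have [] := sf s x Ux|have [] := sg s x Ux].
- move=> _ [s [->|->]] i.
  + exists (dpart (i :: s) f); first by apply: alg_gen; exists (i :: s); left.
    by move=> x; apply: smooth_onP.
  + exists (dpart (i :: s) g); first by apply: alg_gen; exists (i :: s); right.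
    by move=> x; apply: smooth_onP.
Qed.

Lemma smooth_onD U f g : open U -> smooth_on U f -> smooth_on U g ->
  smooth_on U (fun x => f x + g x).
Proof.
move=> oU sf sg; apply: (smooth_on_gen2 oU sf sg).
by apply: alg_add; apply: alg_gen; exists [::]; [left|right].
Qed.

Lemma smooth_onM U f g : open U -> smooth_on U f -> smooth_on U g ->
  smooth_on U (fun x => f x * g x).
Proof.
move=> oU sf sg; apply: (smooth_on_gen2 oU sf sg).
by apply: alg_mul; apply: alg_gen; exists [::]; [left|right].
Qed.

Lemma smooth_on_cst U (c : R) : open U -> smooth_on U (fun=> c).
Proof.
move=> oU; apply: (@smooth_on_family _ (fun h => exists c, h = fun=> c)) => //.
- split=> _ [a ->] i; first by move=> _; exact: cst_continuous.
  by exists (fun=> 0); [exists 0|move=> x _; exact: is_derive_cst].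
- by exists c.
Qed.

Lemma smooth_onZ U f (c : R) : open U -> smooth_on U f ->
  smooth_on U (fun x => c * f x).
Proof. by move=> oU sf; apply: smooth_onM => //; apply: smooth_on_cst. Qed.

Lemma smooth_onN U f : open U -> smooth_on U f -> smooth_on U (fun x => - f x).
Proof.
move=> oU sf; have := smooth_onZ (-1) oU sf.
by apply: smooth_on_near => // x _; rewrite mulN1r.
Qed.

Lemma smooth_on_sum U (I : Type) (r : seq I) (P : pred I) (F : I -> 'rV[R]_N -> R) :
  open U -> (forall i, smooth_on U (F i)) ->
  smooth_on U (fun x => \sum_(i <- r | P i) F i x).
Proof.
move=> oU sF; elim: r => [|i r IH].
  by apply: (smooth_on_near oU _ (smooth_on_cst 0 oU)) => x _; rewrite big_nil.
have : smooth_on U (fun x => (if P i then F i x else 0) + \sum_(j <- r | P j) F j x).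
  by apply: smooth_onD => //; case: (P i) => //; apply: smooth_on_cst.
apply: smooth_on_near => // x _; rewrite big_cons.
by case: (P i); rewrite ?add0r.
Qed.

Lemma dpartD U f g s : open U -> smooth_on U f -> smooth_on U g ->
  forall x, U x -> dpart s (fun x => f x + g x) x = dpart s f x + dpart s g x.
Proof.
move=> oU sf sg; elim: s => //= i s IH x Ux.
suff /(@derive_val _ _ _ _ _ _ _) : is_derive x (ebasis R i)
    (dpart s (fun x => f x + g x)) (dpart (i :: s) f x + dpart (i :: s) g x) by [].
apply: (@near_eq_is_derive _ _ _ (fun x => dpart s f x + dpart s g x)).
  by near do (apply/esym; apply: IH); exact: open_nbhs_nbhs.
by apply: is_derive_add; [exact: smooth_onP sf Ux|exact: smooth_onP sg Ux].
Unshelve. all: by end_near. Qed.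

Lemma dpartZ U f (c : R) s : open U -> smooth_on U f ->
  forall x, U x -> dpart s (fun x => c * f x) x = c * dpart s f x.
Proof.
move=> oU sf; elim: s => //= i s IH x Ux.
suff /(@derive_val _ _ _ _ _ _ _) : is_derive x (ebasis R i)
    (dpart s (fun x => c * f x)) (c * dpart (i :: s) f x) by [].
apply: (@near_eq_is_derive _ _ _ (fun x => c * dpart s f x)).
  by near do (apply/esym; apply: IH); exact: open_nbhs_nbhs.
have := is_derive_mul (is_derive_cst c x (ebasis R i)) (smooth_onP s i sf Ux).
by rewrite mul0r add0r.
Unshelve. all: by end_near. Qed.

Lemma dpartN U f s : open U -> smooth_on U f ->
  forall x, U x -> dpart s (fun x => - f x) x = - dpart s f x.
Proof.
move=> oU sf x Ux; rewrite -mulN1r -(dpartZ (-1) s oU sf) //.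
by apply: (dpart_near _ oU) => // y _; rewrite mulN1r.
Qed.

Lemma dpart_cst0 s x : dpart s (fun=> 0 : R) x = 0.
Proof.
have oT := @openT 'rV[R]_N.
rewrite (@dpart_near setT (fun=> 0) (fun=> 0 * 0) s oT) //; last first.
  by move=> y _; rewrite mul0r.
by rewrite (dpartZ 0 s oT (smooth_on_cst 0 oT)) // mul0r.
Qed.

Lemma smooth_on_sub U W f : W `<=` U -> smooth_on U f -> smooth_on W f.
Proof. by move=> WU sf s x /WU; exact: sf. Qed.

Lemma smooth_on_cup U W f : smooth_on U f -> smooth_on W f -> smooth_on (U `|` W) f.
Proof. by move=> sU sW s x [/sU|/sW]; apply. Qed.

End Smooth.

(** * Kernels closed under differentiation *)

Section Expressions.
Variables (R : realType) (N : nat).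
Implicit Types (x v w z : 'rV[R]_N) (d : R).

Definition dot v w : R := \sum_i v 0 i * w 0 i.

Definition sq d x : R := dot x x + d ^+ 2.

(** The derivatives of s^(-1/2) and of ln s are polynomials in [Kinv] and linear forms, so these
    atoms close the syntax under differentiation. *)
Inductive expr : Type :=
| Kcst of R | Klin of 'rV[R]_N | Ksq | Kinv | Klog | Kadd of expr & expr | Kmul of expr & expr.

(* With s = |x|^2 + d^2, the atoms Ksq, Kinv and Klog stand for s, s^(-1/2) and
   ln s; d is the regularization parameter, and d = 0 gives singular kernels. *)
Fixpoint ev d (e : expr) x : R :=
  match e with
  | Kcst c => c
  | Klin w => dot w x
  | Ksq => sq d x
  | Kinv => expR (- (ln (sq d x) / 2))
  | Klog => ln (sq d x)
  | Kadd e1 e2 => ev d e1 x + ev d e2 x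
  | Kmul e1 e2 => ev d e1 x * ev d e2 x
  end.

Fixpoint eD v (e : expr) : expr :=
  match e with
  | Kcst _ => Kcst 0
  | Klin w => Kcst (dot w v)
  | Ksq => Kmul (Kcst 2) (Klin v)
  | Kinv => Kmul (Kcst (-1)) (Kmul (Klin v) (Kmul Kinv (Kmul Kinv Kinv)))
  | Klog => Kmul (Kcst 2) (Kmul (Klin v) (Kmul Kinv Kinv))
  | Kadd e1 e2 => Kadd (eD v e1) (eD v e2)
  | Kmul e1 e2 => Kadd (Kmul (eD v e1) e2) (Kmul e1 (eD v e2))
  end.

Definition eDs (s : seq 'I_N) (e : expr) : expr :=
  foldr (fun i e => eD (ebasis R i) e) e s.

Lemma dotC v w : dot v w = dot w v.
Proof. by apply: eq_bigr => i _; rewrite mulrC. Qed.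

Lemma dotZl (a : R) v w : dot (a *: v) w = a * dot v w.
Proof. by rewrite /dot big_distrr; apply: eq_bigr => i _; rewrite mxE /= mulrA. Qed.

Lemma dotNl v w : dot (- v) w = - dot v w.
Proof. by rewrite -scaleN1r dotZl mulN1r. Qed.

Lemma dot_ge0 v : 0 <= dot v v.
Proof. by apply: sumr_ge0 => i _; rewrite -expr2 sqr_ge0. Qed.

Lemma dot_eq0 v : (dot v v == 0) = (v == 0).
Proof.
apply/eqP/eqP => [h|->]; last by rewrite /dot big1 // => i _; rewrite mxE mul0r.
apply/rowP => i; rewrite mxE; apply/eqP; rewrite -sqrf_eq0 expr2.
move/eqP: h; rewrite psumr_eq0 => [/allP/(_ i)|j _]; last by rewrite -expr2 sqr_ge0.
by rewrite mem_index_enum => /(_ isT).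
Qed.

Lemma dot_ebasis i w : dot (ebasis R i) w = w 0 i.
Proof.
rewrite /dot (bigD1 i) //= big1 ?addr0 => [|j ji]; rewrite /ebasis mxE eqxx /=.
  by rewrite eqxx mul1r.
by rewrite (negbTE ji) mul0r.
Qed.

Lemma sq_gt0 d x : d != 0 -> 0 < sq d x.
Proof. by move=> d0; rewrite ltr_wpDl ?dot_ge0 // exprn_even_gt0. Qed.

Lemma sq_gt0_x d x : x != 0 -> 0 < sq d x.
Proof. by move=> x0; rewrite ltr_pwDl ?sqr_ge0 // lt_def dot_ge0 dot_eq0 x0. Qed.

Lemma is_derive_coord x v i : is_derive x v (fun y => y 0 i) (v 0 i).
Proof.
apply/is_derive_line.
have -> : (fun h => (h *: v + x) 0 i) = (fun h => h * v 0 i + x 0 i).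
  by apply/funext => h; rewrite !mxE.
have := is_derive_add (is_derive_mul (is_derive_id (0 : R) 1)
  (is_derive_cst (v 0 i) (0 : R) 1)) (is_derive_cst (x 0 i) (0 : R) 1).
by rewrite mul1r mulr0 !addr0.
Qed.

Lemma is_derive_dot x v w : is_derive x v (dot w) (dot w v).
Proof.
rewrite /dot; apply: (@is_derive_fsum _ _ _ _ _ (fun i _ => w 0 i * v 0 i)) => i.
have := is_derive_mul (is_derive_cst (w 0 i) x v) (is_derive_coord x v i).
by rewrite mul0r add0r.
Qed.

Lemma is_derive_sq d x v : is_derive x v (sq d) (2 * dot v x).
Proof.
have h : is_derive x v (fun y => dot y y) (\sum_i (v 0 i * x 0 i + x 0 i * v 0 i)).
  apply: (@is_derive_fsum _ _ _ _ _ (fun i _ => v 0 i * x 0 i + x 0 i * v 0 i)) => i.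
  exact: (is_derive_mul (is_derive_coord x v i) (is_derive_coord x v i)).
have -> : 2 * dot v x = \sum_i (v 0 i * x 0 i + x 0 i * v 0 i) + 0.
  rewrite addr0 /dot big_distrr; apply: eq_bigr => i _.
  by rewrite /=; ring.
exact: is_derive_add h (is_derive_cst _ _ _).
Qed.

Lemma ev_Inv_sqr d x : 0 < sq d x -> ev d Kinv x * ev d Kinv x = (sq d x)^-1.
Proof.
move=> s0 /=; rewrite -expRD -opprD -splitr expRN lnK //.
Qed.

Lemma is_derive_ev d e x v : 0 < sq d x -> is_derive x v (ev d e) (ev d (eD v e) x).
Proof.
move=> s0.
have dL : is_derive x v (ev d Klog) (2 * (dot v x * (ev d Kinv x * ev d Kinv x))).
  apply: (is_derive_eq (is_derive_comp1 (is_derive_sq d x v) (is_derive1_ln s0))).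
  by rewrite ev_Inv_sqr // mulrC -mulrA.
elim: e => [c|w||||e1 IH1 e2 IH2|e1 IH1 e2 IH2].
- exact: is_derive_cst.
- exact: is_derive_dot.
- exact: is_derive_sq.
- have dL2 := is_derive_mul (is_derive_cst (- 2^-1 : R) x v) dL.
  have dE := is_derive_comp1 dL2 (is_derive_expR _).
  have -> : ev d Kinv = fun y => expR (- 2^-1 * ev d Klog y).
    by apply/funext => y /=; rewrite mulNr [2^-1 * _]mulrC.
  apply: (is_derive_eq dE) => /=; rewrite mul0r add0r.
  by rewrite mulNr [2^-1 * _]mulrC; set F := expR _; field.
- exact: dL.
- exact: is_derive_add.
- exact: is_derive_mul.
Qed.

Lemma continuous_fsum (I : Type) (r : seq I) (F : I -> 'rV[R]_N -> R) x :
  (forall i, {for x, continuous (F i)}) ->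
  {for x, continuous (fun y => \sum_(i <- r) F i y)}.
Proof.
move=> h; elim: r => [|i r IH].
  have -> : (fun y => \sum_(i <- [::]) F i y) = fun=> 0.
    by apply/funext => y; rewrite big_nil.
  exact: cst_continuous.
have -> : (fun y => \sum_(j <- i :: r) F j y) = fun y => F i y + \sum_(j <- r) F j y.
  by apply/funext => y; rewrite big_cons.
exact: continuousD.
Qed.

Lemma continuous_dot w : continuous (dot w).
Proof.
move=> x; apply: (@continuous_fsum 'I_N _ (fun i y => w 0 i * y 0 i)) => i.
by apply: continuousM; [exact: cst_continuous|exact: coord_continuous].
Qed.

Lemma continuous_sq d : continuous (sq d).
Proof.
move=> x; apply: (@continuousD _ _ _ (fun y => dot y y) (fun=> d ^+ 2)); last exact: cst_continuous.
apply: (@continuous_fsum 'I_N _ (fun i y => y 0 i * y 0 i)) => i.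
by apply: continuousM; exact: coord_continuous.
Qed.

Lemma continuous_ev d e x : 0 < sq d x -> {for x, continuous (ev d e)}.
Proof.
move=> s0.
have cL : {for x, continuous (ev d Klog)}.
  by apply: (@continuous_comp _ _ _ (sq d) (@ln R)); [exact: continuous_sq|exact: continuous_ln].
elim: e => [c|w||||e1 IH1 e2 IH2|e1 IH1 e2 IH2].
- exact: cst_continuous.
- exact: continuous_dot.
- exact: continuous_sq.
- apply: (@continuous_comp _ _ _ (fun y => - (ln (sq d y) / 2)) (@expR R)).
    by apply: continuousN; apply: continuousM => //; exact: cst_continuous.
  exact: continuous_expR.
- exact: cL.
- exact: continuousD.
- exact: continuousM.
Qed.

Lemma continuous_shift_comp (g : 'rV[R]_N -> R) z x :
  {for x - z, continuous g} -> {for x, continuous (fun y : 'rV[R]_N => g (y - z))}.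
Proof.
move=> gc; apply: (@continuous_comp 'rV[R]_N 'rV[R]_N R (fun y : 'rV[R]_N => y - z) g) => //.
by apply: (@continuousB R 'rV[R]_N 'rV[R]_N id (fun=> z)); [exact: cvg_id|exact: cst_continuous].
Qed.

Definition regular_at d z : set 'rV[R]_N := [set x | 0 < sq d (x - z)].

Lemma open_regular d z : open (regular_at d z).
Proof.
have -> : regular_at d z = (fun x => sq d (x - z)) @^-1` [set y | 0 < y] by [].
apply: open_comp; last exact: open_gt.
by move=> x _; apply: continuous_shift_comp; exact: continuous_sq.
Qed.

Lemma is_derive_ev_shift d e x v z : 0 < sq d (x - z) ->
  is_derive x v (fun y => ev d e (y - z)) (ev d (eD v e) (x - z)).
Proof.
move=> /(is_derive_ev e v)/is_derive_line h; apply/is_derive_line.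
by under eq_fun do rewrite -addrA.
Qed.

Lemma is_derive_ev_flip d e x v z : 0 < sq d (z - x) ->
  is_derive x v (fun y => ev d e (z - y)) (- ev d (eD v e) (z - x)).
Proof.
move=> s0; have h := is_derive_ev e v s0.
have hN : is_derive (z - x) (- v) (ev d e) (- ev d (eD v e) (z - x)).
  apply: (is_derive_eq (is_derive_ev e (- v) s0)).
  elim: e {h} => //=.
  - by move=> _; rewrite oppr0.
  - by move=> w; rewrite !(dotC w) dotNl.
  - by rewrite dotNl mulrN.
  - by rewrite dotNl !mulNr !mulrN.
  - by rewrite dotNl !mulNr !mulrN.
  - by move=> e1 -> e2 ->; rewrite opprD.
  - by move=> e1 -> e2 ->; rewrite opprD mulNr mulrN.
move/is_derive_line: hN => hN; apply/is_derive_line.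
by under eq_fun do rewrite opprD addrCA -scalerN.
Qed.

Lemma ev_family d z : derivation_closed (regular_at d z)
  (fun f => exists e, f = fun x => ev d e (x - z)).
Proof.
split=> _ [e ->].
- by move=> x s0; apply: continuous_shift_comp; exact: continuous_ev.
- move=> i; exists (fun x => ev d (eD (ebasis R i) e) (x - z)); first by eexists.
  by move=> x; exact: is_derive_ev_shift.
Qed.

Lemma smooth_on_ev d e z : smooth_on (regular_at d z) (fun x => ev d e (x - z)).
Proof.
apply: (smooth_on_family (@open_regular d z) (@ev_family d z)); by exists e.
Qed.

Lemma dpart_ev d e z s x : regular_at d z x ->
  dpart s (fun x => ev d e (x - z)) x = ev d (eDs s e) (x - z).
Proof.
elim: s x => //= i s IH x xz.
suff /(@derive_val _ _ _ _ _ _ _) : is_derive x (ebasis R i)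
    (dpart s (fun x => ev d e (x - z))) (ev d (eD (ebasis R i) (eDs s e)) (x - z)) by [].
apply: (@near_eq_is_derive _ _ _ (fun x => ev d (eDs s e) (x - z))).
  near do (apply/esym; apply: IH).
  by apply: open_nbhs_nbhs; split => //; exact: open_regular.
exact: is_derive_ev_shift.
Unshelve. all: by end_near. Qed.

(** A polynomial identity in the values of the atoms, valid even at the pole: commuting partial
    derivatives costs no analysis. *)
Lemma ev_eD_comm d v w e x : ev d (eD v (eD w e)) x = ev d (eD w (eD v e)) x.
Proof.
elim: e => //=; rewrite ?(dotC w v); try by move=> *; ring.
- by move=> e1 -> e2 ->.
- by move=> e1 -> e2 ->; ring.
Qed.

(** Relations such as s (s^(-1/2))^2 = 1 hold between values and off the pole, not between
    expressions; they are used modulo [eqv]. *)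
Definition eqv d e1 e2 := forall x, 0 < sq d x -> ev d e1 x = ev d e2 x.

(** The values agree on an open set, where [eD] computes the genuine derivative. *)
Lemma eqv_eD d v e1 e2 : eqv d e1 e2 -> eqv d (eD v e1) (eD v e2).
Proof.
move=> h x s0; have [_ <-] := is_derive_ev e1 v s0.
have [_ <-] := is_derive_ev e2 v s0; apply: near_eq_derive.
have := @open_regular d 0; rewrite openE => /(_ x).
rewrite /interior /= /regular_at /= subr0 => /(_ s0).
by apply: filterS => y /=; rewrite subr0; exact: h.
Qed.

Lemma eqv_eDs d s e1 e2 : eqv d e1 e2 -> eqv d (eDs s e1) (eDs s e2).
Proof. by move=> h; elim: s => //= i s; exact: eqv_eD. Qed.

Lemma eqv_eD_eDs d v s e : eqv d (eD v (eDs s e)) (eDs s (eD v e)).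
Proof.
elim: s => //= i s IH x s0; rewrite ev_eD_comm; exact: eqv_eD.
Qed.

Definition sume (I : Type) (r : seq I) (F : I -> expr) : expr :=
  foldr (fun i e => Kadd (F i) e) (Kcst 0) r.

Lemma ev_sume d (I : Type) (r : seq I) (F : I -> expr) x :
  ev d (sume r F) x = \sum_(i <- r) ev d (F i) x.
Proof. by elim: r => [|i r IH] /=; rewrite ?big_nil ?big_cons ?IH. Qed.

Lemma eD_sume v (I : Type) (r : seq I) (F : I -> expr) :
  eD v (sume r F) = sume r (fun i => eD v (F i)).
Proof. by elim: r => //= i r ->. Qed.

End Expressions.

(** * Laplacians of radial kernels *)

Section Kernels.
Variables (R : realType) (N : nat).
Implicit Types (x v w z : 'rV[R]_N) (d : R) (e g h : expr R N).

Local Notation X i := (Klin (ebasis R i)).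

Definition lap e : expr R N :=
  sume (index_enum 'I_N) (fun i => eD (ebasis R i) (eD (ebasis R i) e)).

Lemma eqv_lap d e1 e2 : eqv d e1 e2 -> eqv d (lap e1) (lap e2).
Proof.
move=> h x s0; rewrite /lap !ev_sume; apply: eq_bigr => i _.
by do 2 apply: eqv_eD => //.
Qed.

Lemma ev_lapD d e1 e2 x : ev d (lap (Kadd e1 e2)) x = ev d (lap e1) x + ev d (lap e2) x.
Proof. by rewrite /lap !ev_sume -big_split. Qed.

Lemma ev_scale d (c : R) e x : ev d (Kmul (Kcst N c) e) x = c * ev d e x.
Proof. by []. Qed.

Lemma ev_eDZ d v (c : R) e x : ev d (eD v (Kmul (Kcst N c) e)) x = c * ev d (eD v e) x.
Proof. by rewrite /= mul0r add0r. Qed.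

Lemma ev_lapZ d (c : R) e x : ev d (lap (Kmul (Kcst N c) e)) x = c * ev d (lap e) x.
Proof.
rewrite /lap !ev_sume big_distrr; apply: eq_bigr => i _ /=.
by rewrite !mul0r !add0r.
Qed.

Lemma ev_lap_Cst d c x : ev d (lap (Kcst N c)) x = 0.
Proof. by rewrite /lap ev_sume big1. Qed.

Lemma eqv_eD_lap d v e : eqv d (eD v (lap e)) (lap (eD v e)).
Proof.
move=> x s0; rewrite /lap eD_sume !ev_sume; apply: eq_bigr => i _.
by rewrite ev_eD_comm; apply: eqv_eD s0 => y _; rewrite ev_eD_comm.
Qed.

(** If the gradient of e is x g and that of g is x h, the Laplacian of e is N g + |x|^2 h. Writing
    |x|^2 = s - d^2 separates the classical terms from those due to the regularization. *)
Lemma ev_lap_radial d e g h :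
  (forall i, eqv d (eD (ebasis R i) e) (Kmul (X i) g)) ->
  (forall i, eqv d (eD (ebasis R i) g) (Kmul (X i) h)) ->
  forall x, 0 < sq d x ->
  ev d (lap e) x = N%:R * ev d g x + (sq d x - d ^+ 2) * ev d h x.
Proof.
move=> eg gh x s0; rewrite /lap ev_sume.
transitivity (\sum_i (ev d g x + x 0 i * x 0 i * ev d h x)).
  apply: eq_bigr => i _; rewrite (eqv_eD _ (eg i)) //= (gh i _ s0) /=.
  by rewrite !dot_ebasis /ebasis mxE !eqxx mul1r mulrA.
rewrite big_split /= sumr_const card_ord -big_distrl /= mulr_natl.
by rewrite /sq addrK.
Qed.

Definition ipow n : expr R N := iter n (Kmul (Kinv R N)) (Kcst N 1).

Lemma ev_ipow d n x : ev d (ipow n) x = ev d (Kinv R N) x ^+ n.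
Proof. by elim: n => //= n ->; rewrite exprS. Qed.

Lemma ev_eD_ipow d v n x :
  ev d (eD v (ipow n)) x = - n%:R * dot v x * ev d (Kinv R N) x ^+ n.+2.
Proof.
elim: n => [|n IH]; first by rewrite oppr0 !mul0r.
rewrite [LHS]/= IH ev_ipow /= -[in RHS]natr1 !exprS; set F := expR _; ring.
Qed.

Lemma sq_Inv d x : 0 < sq d x -> sq d x * ev d (Kinv R N) x ^+ 2 = 1.
Proof. by move=> s0; rewrite expr2 ev_Inv_sqr // mulfV // gt_eqF. Qed.

(** With F = s^(-1/2), the gradient of F^n is - n F^(n+2) x, and s F^2 = 1. The leading coefficient
    vanishes for n = N - 2, the Newtonian exponent. *)
Lemma ev_lap_ipow d n x : 0 < sq d x ->
  ev d (lap (ipow n)) x = n%:R * (n%:R + 2 - N%:R) * ev d (Kinv R N) x ^+ n.+2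
    - d ^+ 2 * n%:R * (n%:R + 2) * ev d (Kinv R N) x ^+ n.+4.
Proof.
move=> s0.
rewrite (@ev_lap_radial _ _ (Kmul (Kcst N (- n%:R)) (ipow n.+2))
  (Kmul (Kcst N (n%:R * (n%:R + 2))) (ipow n.+4))) //; last 2 first.
- by move=> i y sy; rewrite ev_eD_ipow /= ev_ipow !exprS /=; set F := expR _; ring.
- move=> i y sy; rewrite ev_eDZ ev_eD_ipow -[n.+2]addn2 natrD /= ev_ipow !exprS /=.
  by set F := expR _; ring.
rewrite !ev_scale !ev_ipow.
have := sq_Inv s0; rewrite (exprS _ n.+3) (exprS _ n.+2); set F := ev d _ x => e1.
have -> : (sq d x - d ^+ 2) * (n%:R * (n%:R + 2) * (F * (F * F ^+ n.+2))) =
  (sq d x * F ^+ 2) * (n%:R * (n%:R + 2) * F ^+ n.+2)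
   - d ^+ 2 * (n%:R * (n%:R + 2) * (F * (F * F ^+ n.+2))) by ring.
by rewrite e1; ring.
Qed.

End Kernels.

Section Biharmonic.
Variable R : realType.

(** Here Phi = s^(1/2), whose Laplacian is 2 F + d^2 F^3 with F = s^(-1/2). In the second Laplacian
    the terms in d^2 F^5 cancel, with coefficients -6 and 6. *)
Lemma biharmonic_kernel3 d (x : 'rV[R]_3) : 0 < sq d x ->
  ev d (lap (lap (Kmul (Ksq R 3) (Kinv R 3)))) x = - 15 * d ^+ 4 * ev d (Kinv R 3) x ^+ 7.
Proof.
move=> s0.
have L1 : eqv d (lap (Kmul (Ksq R 3) (Kinv R 3)))
    (Kadd (Kmul (Kcst 3 2) (ipow R 3 1)) (Kmul (Kcst 3 (d ^+ 2)) (ipow R 3 3))).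
  move=> y sy; rewrite (@ev_lap_radial _ _ _ _ (Kinv R 3) (Kmul (Kcst 3 (-1)) (ipow R 3 3))) //.
  - have := sq_Inv sy; rewrite /=; set F := expR _; set s := sq _ _ => h.
    have -> : (s - d ^+ 2) * (-1 * (F * (F * (F * 1)))) =
       - (s * F ^+ 2) * F + d ^+ 2 * (F * (F * F)) by ring.
    by rewrite h; ring.
  - move=> i z sz; have := sq_Inv sz; rewrite /=; set F := expR _; set s := sq _ _ => h.
    have -> : 2 * dot (ebasis R i) z * F + s * (-1 * (dot (ebasis R i) z * (F * (F * F)))) =
      dot (ebasis R i) z * (2 * F - (s * F ^+ 2) * F) by ring.
    by rewrite h; ring.
  - by move=> i z sz /=; ring.
rewrite (eqv_lap L1) // ev_lapD !ev_lapZ !ev_lap_ipow //.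
by set F := ev d _ x; ring.
Qed.

(** Here Phi = s ln s, whose Laplacian is 4 ln s + 8 - 4 d^2 F^2. In the second Laplacian the terms
    in d^2 F^4 cancel, with coefficients 16 and -16. *)
Lemma biharmonic_kernel2 d (x : 'rV[R]_2) : 0 < sq d x ->
  ev d (lap (lap (Kmul (Ksq R 2) (Klog R 2)))) x = 32 * d ^+ 4 * ev d (Kinv R 2) x ^+ 6.
Proof.
move=> s0.
have L1 : eqv d (lap (Kmul (Ksq R 2) (Klog R 2)))
    (Kadd (Kmul (Kcst 2 4) (Klog R 2)) (Kadd (Kcst 2 8) (Kmul (Kcst 2 (- 4 * d ^+ 2)) (ipow R 2 2)))).
  move=> y sy; rewrite (@ev_lap_radial _ _ _ _ (Kadd (Kmul (Kcst 2 2) (Klog R 2)) (Kcst 2 2))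
    (Kmul (Kcst 2 4) (ipow R 2 2))) //.
  - have := sq_Inv sy; rewrite /=; set F := expR _; set s := sq _ _ => h.
    have -> : (s - d ^+ 2) * (4 * (F * (F * 1))) =
       4 * (s * F ^+ 2) - 4 * d ^+ 2 * (F * F) by ring.
    by rewrite h; ring.
  - move=> i z sz; have := sq_Inv sz; rewrite /=; set F := expR _; set s := sq _ _ => h.
    have -> : 2 * dot (ebasis R i) z * ln s + s * (2 * (dot (ebasis R i) z * (F * F))) =
      dot (ebasis R i) z * (2 * ln s + 2 * (s * F ^+ 2)) by ring.
    by rewrite h; ring.
  - by move=> i z sz /=; ring.
have L2 : ev d (lap (Klog R 2)) x = 4 * d ^+ 2 * ev d (Kinv R 2) x ^+ 4.
  rewrite (@ev_lap_radial _ _ _ _ (Kmul (Kcst 2 2) (ipow R 2 2))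
    (Kmul (Kcst 2 (-4)) (ipow R 2 4))) //.
  - have := sq_Inv s0; rewrite /=; set F := expR _; set s := sq _ _ => h.
    have -> : (s - d ^+ 2) * (-4 * (F * (F * (F * (F * 1))))) =
       -4 * (s * F ^+ 2) * F ^+ 2 + 4 * d ^+ 2 * F ^+ 4 by ring.
    by rewrite h; ring.
  - by move=> i z sz /=; ring.
  - by move=> i z sz /=; ring.
rewrite (eqv_lap L1) // ev_lapD !ev_lapZ ev_lapD ev_lap_Cst ev_lapZ ev_lap_ipow // L2.
by set F := ev d _ x; ring.
Qed.

Lemma biharmonic_kernel N : N = 2%N \/ N = 3%N ->
  exists (Phi : expr R N) (c : R), c != 0 /\
  forall d x, 0 < sq d x -> ev d (lap (lap Phi)) x = c * d ^+ 4 * ev d (Kinv R N) x ^+ (N + 4).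
Proof.
case=> ->.
- exists (Kmul (Ksq R 2) (Klog R 2)), 32; split=> [|d x s0]; first by rewrite pnatr_eq0.
  by rewrite biharmonic_kernel2.
- exists (Kmul (Ksq R 3) (Kinv R 3)), (- 15); split=> [|d x s0].
    by rewrite oppr_eq0 pnatr_eq0.
  by rewrite biharmonic_kernel3.
Qed.

End Biharmonic.

(** * Growth of kernels and of their iterated derivatives *)

Section Bounds.
Variables (R : realType) (N : nat).
Implicit Types (x v w z : 'rV[R]_N) (d : R) (e : expr R N).

(* eD raises edeg by at most 3 and multiplies enorm by at most 2 |v| edeg, so n
   derivations cost a factor n! C^n with C independent of the expression: the
   kernels are analytic, with locally uniform radius. *)
Definition norm1 v : R := \sum_i `|v 0 i|.

Fixpoint enorm e : R :=
  match e with
  | Kcst c => `|c|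
  | Klin w => norm1 w
  | Ksq | Kinv | Klog => 1
  | Kadd e1 e2 => enorm e1 + enorm e2
  | Kmul e1 e2 => enorm e1 * enorm e2
  end.

Fixpoint edeg e : nat :=
  match e with
  | Kcst _ => 0
  | Klin _ | Ksq | Kinv | Klog => 1
  | Kadd e1 e2 => maxn (edeg e1) (edeg e2)
  | Kmul e1 e2 => edeg e1 + edeg e2
  end.

Lemma norm1_ge0 v : 0 <= norm1 v.
Proof. by apply: sumr_ge0 => i _. Qed.

Lemma enorm_ge0 e : 0 <= enorm e.
Proof.
elim: e => //= [w|e1 h1 e2 h2|e1 h1 e2 h2].
- exact: norm1_ge0.
- exact: addr_ge0.
- exact: mulr_ge0.
Qed.

Lemma norm_dot v w : `|dot v w| <= norm1 v * norm1 w.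
Proof.
rewrite /dot (le_trans (ler_norm_sum _ _ _)) // /norm1 big_distrl ler_sum // => i _.
rewrite normrM ler_wpM2l // (bigD1 i) //= lerDl; exact: sumr_ge0.
Qed.

Lemma norm_dot_le v x (M : R) : (forall i, `|x 0 i| <= M) -> `|dot v x| <= norm1 v * M.
Proof.
move=> h; rewrite /dot (le_trans (ler_norm_sum _ _ _)) // /norm1 big_distrl ler_sum //.
by move=> i _; rewrite normrM ler_wpM2l.
Qed.

Lemma sqr_coord_le d x i : x 0 i ^+ 2 <= sq d x.
Proof.
rewrite /sq /dot (bigD1 i) //= -expr2 -addrA lerDl addr_ge0 ?sqr_ge0 //.
by apply: sumr_ge0 => j _; rewrite -expr2 sqr_ge0.
Qed.

Lemma norm_le1_sqr (a b : R) : a ^+ 2 <= b -> `|a| <= 1 + b.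
Proof.
move=> h; have b0 : 0 <= b by apply: le_trans h; exact: sqr_ge0.
have := real_normK (num_real a) => E; rewrite -E in h.
have a0 := normr_ge0 a; nra.
Qed.

(** M = Q + 2 + 1/r is at least 1 and dominates every atom: |a| <= 1 + a^2 controls the coordinates
    and [Kinv], and ln t < t at t = s and t = 1/s controls the logarithm. *)
Lemma ev_bound d e x (r Q : R) : 0 < r -> r <= sq d x -> sq d x <= Q ->
  `|ev d e x| <= enorm e * (Q + 2 + r^-1) ^+ edeg e.
Proof.
move=> r0 rs sQ; set M := Q + 2 + r^-1.
have s0 : 0 < sq d x by exact: lt_le_trans rs.
have ri0 : 0 < r^-1 by rewrite invr_gt0.
have Q0 : 0 < Q by exact: lt_le_trans sQ.
have M1 : 1 <= M by rewrite /M; lra.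
have M0 : 0 <= M by lra.
have siv : (sq d x)^-1 <= r^-1 by rewrite lef_pV2 ?posrE.
have xM i : `|x 0 i| <= M.
  have := norm_le1_sqr (sqr_coord_le d x i); rewrite /M; lra.
have IM : `|ev d (Kinv R N) x| <= M.
  have := norm_le1_sqr (a := ev d (Kinv R N) x) (b := r^-1).
  rewrite expr2 ev_Inv_sqr // => /(_ siv); rewrite /M; lra.
have LM : `|ln (sq d x)| <= M.
  have h1 := ln_sublinear s0.
  have : ln (sq d x)^-1 < (sq d x)^-1 by apply: ln_sublinear; rewrite invr_gt0.
  rewrite lnV ?posrE // => h2.
  by rewrite ler_norml /M; apply/andP; split; lra.
elim: e => [c|w||||e1 IH1 e2 IH2|e1 IH1 e2 IH2]; rewrite [enorm _]/= [edeg _]/=.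
- by rewrite expr0 mulr1.
- by rewrite expr1; exact: norm_dot_le.
- by rewrite mul1r expr1 /= ger0_norm ?(ltW s0) // (le_trans sQ) // /M; lra.
- by rewrite mul1r expr1.
- by rewrite mul1r expr1.
- rewrite mulrDl (le_trans (ler_normD _ _)) // lerD // (le_trans IH1,le_trans IH2) //;
  by rewrite ler_wpM2l ?enorm_ge0 // ler_weXn2l // leq_max leqnn ?orbT.
- rewrite exprD mulrACA normrM ler_pM //.
Qed.

Lemma edeg_eD v e : (edeg (eD v e) <= edeg e + 3)%N.
Proof.
elim: e => //= [e1 h1 e2 h2|e1 h1 e2 h2].
- by rewrite addn_maxl geq_max !leq_max h1 h2 orbT.
- rewrite geq_max; apply/andP; split; first by rewrite addnAC leq_add2r.
  by rewrite -addnA leq_add2l.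
Qed.

Lemma enorm_eD v e : enorm (eD v e) <= 2 * norm1 v * (edeg e)%:R * enorm e.
Proof.
have v0 := norm1_ge0 v.
elim: e => [c|w||||e1 IH1 e2 IH2|e1 IH1 e2 IH2] /=.
- by rewrite normr0 mulr0 mul0r.
- rewrite (le_trans (norm_dot _ _)) // mulr1 mulrC ler_wpM2r ?norm1_ge0 //; lra.
- by rewrite ger0_norm // !mulr1.
- by rewrite normrN normr1 !mulr1; lra.
- by rewrite ger0_norm // !mulr1.
- rewrite mulrDr lerD // (le_trans IH1, le_trans IH2) // ler_wpM2r ?enorm_ge0 //;
  by rewrite ler_wpM2l ?mulr_ge0 // ler_nat leq_max leqnn ?orbT.
- have h1 := ler_wpM2r (enorm_ge0 e2) IH1; have h2 := ler_wpM2l (enorm_ge0 e1) IH2.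
  rewrite natrD; apply: (le_trans (lerD h1 h2)); rewrite le_eqVlt; apply/orP; left.
  by apply/eqP; ring.
Qed.

Lemma edeg_iter_eD v n e : (edeg (iter n (eD v) e) <= edeg e + 3 * n)%N.
Proof.
elim: n => [|n IH]; first by rewrite addn0.
by rewrite iterS mulnS addnCA addnC (leq_trans (edeg_eD _ _)) // leq_add2r.
Qed.

(** Each factor D + 3 j is at most 3 (D + j + 1), which gives 3^n (D + n)! / D!; the binomial
    coefficient of D + n over n is at most 2^(D + n). Hence 6 = 3 * 2. *)
Lemma prod_arith_le (D n : nat) :
  (\prod_(j < n) (D + 3 * j) <= 6 ^ n * 2 ^ D * n`!)%N.
Proof.
have h : (D`! * \prod_(j < n) (D + 3 * j) <= 3 ^ n * (D + n)`!)%N.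
  elim: n => [|n IH]; first by rewrite big_ord0 muln1 expn0 mul1n addn0.
  rewrite big_ord_recr /= mulnA addnS factS expnS.
  apply: (leq_trans (leq_mul IH (leqnn _))).
  rewrite -!mulnA [X in (_ <= X)%N]mulnCA leq_mul2l; apply/orP; right.
  rewrite mulnA [X in (_ <= X)%N]mulnC leq_mul2l; apply/orP; right.
  by rewrite mulnS mulnDr (leq_trans _ (leq_addl _ _)) // leq_add2r leq_pmull.
have b : ('C(D + n, n) <= 2 ^ (D + n))%N.
  have := Pascal 1 1 (D + n); rewrite addn1 => ->.
  have ln : (n < (D + n).+1)%N by rewrite ltnS leq_addl.
  by rewrite (bigD1 (Ordinal ln)) //= !exp1n !muln1 leq_addr.
have f := bin_fact (leq_addl D n); rewrite addnK in f.
rewrite -f in h.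
have D0 := fact_gt0 D.
rewrite -(leq_pmul2l D0) (leq_trans h) //.
rewrite (_ : 6 = 3 * 2)%N // expnMn.
apply: (@leq_trans (3 ^ n * (2 ^ (D + n) * (n`! * D`!)))%N).
  by rewrite leq_mul2l leq_mul2r b !orbT.
rewrite expnD leq_eqVlt; apply/orP; left; apply/eqP; ring.
Qed.

(** 12 = 2 * 6: a factor 2 |v| for each derivation, and the 6^n from the product of the successive
    degrees. *)
Lemma enorm_iter_eD v n e : enorm (iter n (eD v) e) <=
  enorm e * 2 ^+ edeg e * (12 * norm1 v) ^+ n * n`!%:R.
Proof.
have v0 := norm1_ge0 v.
have h : enorm (iter n (eD v) e) <=
    enorm e * (2 * norm1 v) ^+ n * (\prod_(j < n) (edeg e + 3 * j))%:R.
  elim: n => [|n IH]; first by rewrite big_ord0 !mulr1.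
  rewrite iterS (le_trans (enorm_eD _ _)) // big_ord_recr /= natrM exprS.
  apply: (@le_trans _ _ (2 * norm1 v * (edeg e + 3 * n)%:R *
     (enorm e * (2 * norm1 v) ^+ n * (\prod_(j < n) (edeg e + 3 * j))%:R))).
    apply: ler_pM; rewrite ?mulr_ge0 ?enorm_ge0 //.
    by rewrite ler_wpM2l ?mulr_ge0 // ler_nat edeg_iter_eD.
  by rewrite le_eqVlt; apply/orP; left; apply/eqP; ring.
apply: (le_trans h).
have := prod_arith_le (edeg e) n; rewrite -(ler_nat R) !natrM !natrX => p.
apply: (le_trans (ler_wpM2l _ p)).
  by rewrite mulr_ge0 ?enorm_ge0 // exprn_ge0 // mulr_ge0.
have -> : 12 * norm1 v = 6 * (2 * norm1 v) by ring.
by rewrite [(6 * _) ^+ n]exprMn le_eqVlt; apply/orP; left; apply/eqP; ring.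
Qed.

Lemma Log_diff d x (r : R) : 0 < r -> r <= dot x x ->
  0 <= ln (sq d x) - ln (sq 0 x) <= d ^+ 2 / r.
Proof.
move=> r0 rx; have x0 : 0 < dot x x by exact: lt_le_trans rx.
rewrite /sq expr0n addr0 -ln_div ?posrE //; last by rewrite ltr_pwDl // sqr_ge0.
rewrite mulrDl divff ?gt_eqF //.
have q0 : 0 <= d ^+ 2 / dot x x by rewrite divr_ge0 ?sqr_ge0 // ltW.
rewrite ln_ge0 /=; last by rewrite lerDl.
rewrite (le_trans (le_ln1Dx _)) //; first by rewrite (lt_le_trans _ q0) // ltrN10.
by rewrite ler_wpM2l ?sqr_ge0 // lef_pV2 ?posrE.
Qed.

(** On an annulus around the pole, ln(1 + t) <= t handles the logarithm, 1 - exp(-t) <= t handles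
    s^(-1/2), and products telescope with the bounds of [ev_bound]. *)
Lemma ev_cvg0 e (r Q : R) : 0 < r -> exists2 C : R, 0 <= C & forall d x, `|d| <= 1 ->
  r <= dot x x -> dot x x <= Q -> `|ev d e x - ev 0 e x| <= C * d ^+ 2.
Proof.
move=> r0.
have B e' : exists2 C : R, 0 <= C & forall d x, `|d| <= 1 ->
    r <= dot x x -> dot x x <= Q -> `|ev d e' x| <= C.
  exists (enorm e' * (`|Q| + 1 + 2 + r^-1) ^+ edeg e').
    by rewrite mulr_ge0 ?enorm_ge0 // exprn_ge0 // !addr_ge0 // invr_ge0 ltW.
  move=> d x d1 rx xQ; apply: ev_bound => //.
    by rewrite /sq (le_trans rx) // lerDl sqr_ge0.
  rewrite /sq lerD // ?(le_trans xQ) ?ler_norm //.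
  by rewrite -(real_normK (num_real d)) expr_le1.
have x0 d x : r <= dot x x -> 0 < sq d x.
  by move=> rx; rewrite /sq ltr_pwDl ?sqr_ge0 // (lt_le_trans r0).
elim: e => [c|w||||e1 [C1 C10 h1] e2 [C2 C20 h2]|e1 [C1 C10 h1] e2 [C2 C20 h2]].
- by exists 0 => // d x _ _ _; rewrite /= subrr normr0 mul0r.
- by exists 0 => // d x _ _ _; rewrite /= subrr normr0 mul0r.
- exists 1 => // d x _ _ _; rewrite /= /sq expr0n addr0 addrC addKr mul1r.
  by rewrite ger0_norm ?sqr_ge0.
- have [B0 B00 hB] := B (Kinv R N).
  exists (B0 * r^-1); first by rewrite mulr_ge0 // invr_ge0 ltW.
  move=> d x d1 rx xQ.
  have /andP[l1 l2] := Log_diff d r0 rx.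
  have := hB 0 x; rewrite normr0 ler01 => /(_ isT rx xQ) hI.
  rewrite /= in hI *; set a := ln (sq d x) in l1 l2 *; set b := ln (sq 0 x) in l1 l2 hI *.
  have -> : - (a / 2) = - (b / 2) + - ((a - b) / 2) by lra.
  rewrite expRD; set E := expR (- (b / 2)) in hI *.
  set t := (a - b) / 2; have t0 : 0 <= t by rewrite /t; lra.
  have -> : E * expR (- t) - E = - (E * (1 - expR (- t))) by ring.
  have t1 : 0 <= 1 - expR (- t) by rewrite subr_ge0 expR_le1 oppr_le0.
  have t2 : 1 - expR (- t) <= t by have := expR_ge1Dx (- t); lra.
  rewrite normrN normrM -mulrA ler_pM // ger0_norm //.
  by rewrite (le_trans t2) // mulrC (le_trans _ l2) // /t; lra.
- exists r^-1; first by rewrite invr_ge0 ltW.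
  move=> d x d1 rx xQ /=; have /andP[l1 l2] := Log_diff d r0 rx.
  by rewrite ger0_norm // mulrC.
- exists (C1 + C2); first exact: addr_ge0.
  move=> d x d1 rx xQ /=; rewrite opprD addrACA mulrDl (le_trans (ler_normD _ _)) //.
  by rewrite lerD // (h1,h2).
- have [B1 B10 hB1] := B e1; have [B2 B20 hB2] := B e2.
  exists (C1 * B2 + B1 * C2); first by rewrite addr_ge0 // mulr_ge0.
  move=> d x d1 rx xQ /=.
  have -> : ev d e1 x * ev d e2 x - ev 0 e1 x * ev 0 e2 x =
     (ev d e1 x - ev 0 e1 x) * ev d e2 x + ev 0 e1 x * (ev d e2 x - ev 0 e2 x) by ring.
  rewrite [X in _ <= X]mulrDl (le_trans (ler_normD _ _)) // lerD // normrM.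
    by rewrite mulrAC ler_pM // (h1, hB2).
  rewrite -mulrA ler_pM // ?h2 // hB1 //; by rewrite normr0.
Qed.

End Bounds.

(** * Cut-off functions *)

Section Norms.
Variables (R : realType) (N : nat).
Implicit Types (x y z : 'rV[R]_N).

Lemma coord_le_norm x i : `|x 0 i| <= `|x|.
Proof.
have -> : `|x| = \big[Num.max/0]_ij `|x ij.1 ij.2| by exact: mx_normrE.
exact: (le_bigmax _ (fun ij : 'I_1 * 'I_N => `|x ij.1 ij.2|) (0, i)).
Qed.

Lemma norm_le_coord x (r : R) : 0 <= r -> (forall i, `|x 0 i| <= r) -> `|x| <= r.
Proof.
move=> r0 h; have [x0|/mx_norm_neq0[[i j]]] := eqVneq (`|x|) 0; first by rewrite x0.
by move=> e; rewrite [X in X <= _]e /= ord1.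
Qed.

Lemma norm_sqr_le_dot x : `|x| ^+ 2 <= dot x x.
Proof.
have [x0|/mx_norm_neq0[[i j]]] := eqVneq (`|x|) 0; first by rewrite x0 expr0n dot_ge0.
move=> e; rewrite [X in X ^+ 2 <= _]e /= ord1 real_normK ?num_real //.
by have := sqr_coord_le 0 x j; rewrite /sq expr0n addr0.
Qed.

(** The norm of row vectors is the maximum norm, whereas the kernels are Euclidean; this is where
    factors N and N + 1 in later radii and constants come from. *)
Lemma dot_le_norm_sqr x : dot x x <= N%:R * `|x| ^+ 2.
Proof.
rewrite /dot (@le_trans _ _ (\sum_(i < N) `|x| ^+ 2)) //; last first.
  by rewrite sumr_const card_ord mulr_natl.
apply: ler_sum => i _; rewrite -expr2 -(real_normK (num_real (x 0 i))).
by rewrite lerXn2r ?nnegrE ?coord_le_norm.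
Qed.

Lemma bounded_set_norm (A : set 'rV[R]_N) : bounded_set A ->
  exists2 B : R, 0 <= B & forall x, A x -> `|x| <= B.
Proof.
move=> [M [_ hM]]; exists (`|M| + 1); first by have := normr_ge0 M; lra.
by move=> x; apply: hM; have := ler_norm M; lra.
Qed.

End Norms.

Section FlatFunction.
Variable R : realType.

(** exp(-1/t) extended by 0, with a power t^(-m) carried along so that the derivatives are
    combinations of members of the same family. *)
Definition flat (m : nat) (t : R) : R := if 0 < t then t^-1 ^+ m * expR (- t^-1) else 0.

Lemma flat_gt0 (t : R) : 0 < t -> 0 < flat 0 t.
Proof. by move=> t0; rewrite /flat t0 expr0 mul1r expR_gt0. Qed.

Lemma flat_ge0 (m : nat) (t : R) : 0 <= flat m t.
Proof.
rewrite /flat; case: ifPn => // t0.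
by rewrite mulr_ge0 ?expR_ge0 // exprn_ge0 // invr_ge0 ltW.
Qed.

Lemma flat_le0 (m : nat) (t : R) : t <= 0 -> flat m t = 0.
Proof. by move=> t0; rewrite /flat ltNge t0. Qed.

(** Keep the term of order m + 2 in the exponential series at 1/t. A quadratic bound forces the
    derivative at 0 to vanish. *)
Lemma flat_le_sqr (m : nat) (t : R) : flat m t <= (m.+2)`!%:R * t ^+ 2.
Proof.
rewrite /flat; case: ifPn => t0; last by rewrite mulr_ge0 ?sqr_ge0.
have ti0 : 0 < t^-1 by rewrite invr_gt0.
have f0 : 0 < (m.+2)`!%:R :> R by rewrite ltr0n fact_gt0.
have h : t^-1 ^+ m.+2 / (m.+2)`!%:R <= expR t^-1.
  by apply: (le_trans _ (expR_ge1Dxn m.+1 (ltW ti0))); rewrite lerDr.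
rewrite expRN ler_pdivrMr ?expR_gt0 //.
have -> : t^-1 ^+ m = (m.+2)`!%:R * t ^+ 2 * (t^-1 ^+ m.+2 / (m.+2)`!%:R).
  rewrite !exprS expr0; move: (m.+2)`!%:R f0 {h} => c c0; set p := t^-1 ^+ m; field.
  by rewrite !gt_eqF.
by rewrite ler_wpM2l // mulr_ge0 ?sqr_ge0 // ltW.
Qed.

Lemma is_derive_flat0 (f : R -> R) (C : R) : (forall t, `|f t| <= C * t ^+ 2) ->
  is_derive (0 : R) 1 f 0.
Proof.
move=> h.
have f0 : f 0 = 0.
  by apply/eqP; rewrite -normr_le0 (le_trans (h 0)) // expr0n mulr0.
have C0 : 0 <= C by have := le_trans (normr_ge0 _) (h 1); rewrite expr1n mulr1.
have c : (fun t => t^-1 *: ((f \o shift 0) (t *: (1 : R)) - f 0)) @ 0^' --> (0 : R).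
  apply/cvgr0Pnorm_le => e e0; near=> t.
  rewrite /= addr0 f0 subr0 [t *: _]mulr1 normrZ normfV.
  have t0 : t != 0 by near: t; exact: nbhs_dnbhs_neq.
  rewrite mulrC ler_pdivrMr ?normr_gt0 // (le_trans (h t)) //.
  rewrite -(real_normK (num_real t)) expr2 mulrA ler_wpM2r //.
  have : `|t| <= e / (C + 1).
    near: t; apply: dnbhs0_le; rewrite divr_gt0 //; lra.
  rewrite ler_pdivlMr; last lra.
  have := normr_ge0 t; nra.
split; first by apply/cvg_ex; exists 0.
exact/cvg_lim.
Unshelve. all: by end_near. Qed.

Lemma is_derive_flat (m : nat) (t : R) :
  is_derive t 1 (flat m) (flat m.+2 t - m%:R * flat m.+1 t).
Proof.
have [t0|t0|->] := ltgtP t 0.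
- rewrite !flat_le0 ?(ltW t0) // mulr0 subr0.
  apply: (@near_eq_is_derive _ _ _ (fun=> 0)).
  near=> s; rewrite flat_le0 // ltW //; near: s; exact: lt_nbhsl.
- apply: (@near_eq_is_derive _ _ _ (fun s : R => s^-1 ^+ m * expR (- s^-1))).
    near=> s; rewrite /flat ifT //; near: s; exact: lt_nbhsr.
  have tn : t != 0 by rewrite gt_eqF.
  have dV : is_derive t 1 (fun s : R => s^-1) (- t ^- 2).
    apply: DeriveDef; first exact: derivableV.
    by rewrite (@deriveV _ _ id) // derive_id [LHS]mulr1.
  have dE := is_derive_comp1 (is_derive_mul (is_derive_cst (-1 : R) t 1) dV) (is_derive_expR _).
  have dX : is_derive t 1 (fun s : R => s^-1 ^+ m) (- m%:R * t^-1 ^+ m.+1).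
    elim: (m) => [|k IH].
      by rewrite oppr0 mul0r; under eq_fun do rewrite expr0; exact: is_derive_cst.
    under eq_fun do rewrite exprS.
    apply: (is_derive_eq (is_derive_mul dV IH)).
    by rewrite -exprVn -[in RHS]natr1 !exprS expr0; ring.
  have -> : (fun s : R => s^-1 ^+ m * expR (- s^-1)) = fun s => s^-1 ^+ m * expR (-1 * s^-1).
    by apply/funext => s; rewrite mulN1r.
  apply: (is_derive_eq (is_derive_mul dX dE)).
  rewrite /flat t0 /= mul0r add0r -exprVn mulN1r !exprS expr0; ring.
- rewrite !flat_le0 // mulr0 subr0; apply: (@is_derive_flat0 _ (m.+2)`!%:R) => s.
  by rewrite ger0_norm ?flat_ge0 // flat_le_sqr.
Unshelve. all: by end_near. Qed.

Lemma continuous_flat (m : nat) : continuous (flat m).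
Proof.
move=> t; apply: differentiable_continuous; apply/derivable1_diffP.
by have [] := is_derive_flat m t.
Qed.

End FlatFunction.

Section Cutoffs.
Variables (R : realType) (N : nat).
Implicit Types (x y z : 'rV[R]_N) (f q : 'rV[R]_N -> R).

Lemma smooth_on_flat q : smooth_on setT q -> smooth_on setT (fun x => flat 0 (q x)).
Proof.
move=> sq.
pose G f := exists s, exists c : R, exists m : nat,
  [\/ f = dpart s q, f = (fun=> c) | f = fun x => flat m (q x)].
apply: (@smooth_on_alg _ _ setT G) => //; last first.
- by apply: alg_gen; exists [::], 0, 0%N; constructor 3.
- move=> f [s [c [m [->|->|->]]]] i.
  + exists (dpart (i :: s) q); first by apply: alg_gen; exists (i :: s), 0, 0%N; constructor 1.
    by move=> x xT; exact: (smooth_onP s i sq xT).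
  + exists (fun=> 0); first by apply: alg_gen; exists [::], 0, 0%N; constructor 2.
    by move=> x _; exact: is_derive_cst.
  + have gf k : alg_closure G (fun x => flat k (q x)).
      by apply: alg_gen; exists [::], 0, k; constructor 3.
    have gc k : alg_closure G (fun x => k).
      by apply: alg_gen; exists [::], k, 0%N; constructor 2.
    exists (fun x => (flat m.+2 (q x) + (- m%:R) * flat m.+1 (q x)) * dpart [:: i] q x).
      apply: alg_mul; last by apply: alg_gen; exists [:: i], 0, 0%N; constructor 1.
      by apply: alg_add => //; apply: alg_mul.
    move=> x xT; rewrite mulNr.
    exact: (is_derive_comp1 (smooth_onP [::] i sq xT) (is_derive_flat m (q x))).
- move=> f [s [c [m [->|->|->]]]] x _.
  + by have [] := sq s x I.
  + exact: cst_continuous.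
  + apply: (@continuous_comp _ _ _ q (flat m)); last exact: continuous_flat.
    by have [] := sq [::] x I.
- exact: openT.
Qed.

Lemma smooth_onV f : smooth_on setT f -> (forall x, f x != 0) ->
  smooth_on setT (fun x => (f x)^-1).
Proof.
move=> sf fn0.
pose G g := exists s, exists c : R,
  [\/ g = dpart s f, g = (fun=> c) | g = fun x => (f x)^-1].
apply: (@smooth_on_alg _ _ setT G) => //; last first.
- by apply: alg_gen; exists [::], 0; constructor 3.
- move=> g [s [c [->|->|->]]] i.
  + exists (dpart (i :: s) f); first by apply: alg_gen; exists (i :: s), 0; constructor 1.
    by move=> x xT; exact: (smooth_onP s i sf xT).
  + exists (fun=> 0); first by apply: alg_gen; exists [::], 0; constructor 2.
    by move=> x _; exact: is_derive_cst.
  + have gi : alg_closure G (fun x => (f x)^-1).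
      by apply: alg_gen; exists [::], 0; constructor 3.
    exists (fun x => -1 * ((f x)^-1 * (f x)^-1) * dpart [:: i] f x).
      apply: alg_mul; last by apply: alg_gen; exists [:: i], 0; constructor 1.
      by apply: alg_mul; [apply: alg_gen; exists [::], (-1); constructor 2|exact: alg_mul].
    move=> x xT; have [d e] := smooth_onP [::] i sf xT.
    apply: DeriveDef; first exact: derivableV.
    by rewrite (deriveV (fn0 x) d) e mulN1r -invfM -expr2.
- move=> g [s [c [->|->|->]]] x _.
  + by have [] := sf s x I.
  + exact: cst_continuous.
  + by apply: continuousV => //; have [] := sf [::] x I.
- exact: openT.
Qed.

Lemma bump_dot z (a b : R) : a < b -> exists chi : 'rV[R]_N -> R,
  [/\ smooth_on setT chi, forall x, 0 <= chi x,
      forall x, dot (x - z) (x - z) <= a -> chi x = 1 &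
      forall x, b <= dot (x - z) (x - z) -> chi x = 0].
Proof.
move=> ab.
(* With d = 1 the expression is regular everywhere; the additional 1 reappears in the thresholds b +
   1 and a + 1. *)
pose q x := ev 1 (Ksq R N) (x - z).
have qE x : q x = dot (x - z) (x - z) + 1 by rewrite /q /= /sq expr1n.
have sq : smooth_on setT q.
  apply: (@smooth_on_sub _ _ (regular_at 1 z)); last exact: smooth_on_ev.
  by move=> x _; apply: sq_gt0; rewrite oner_eq0.
have oT := @openT 'rV[R]_N.
(* f vanishes beyond b and g up to a; since a < b they have no common zero, and f / (f + g) is the
   cut-off. *)
pose f x := flat 0 (b + 1 + -1 * q x).
pose g x := flat 0 (q x + - (a + 1)).
have sf : smooth_on setT f.
  exact: (smooth_on_flat (smooth_onD oT (smooth_on_cst (b + 1) oT) (smooth_onZ (-1) oT sq))).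
have sg : smooth_on setT g.
  exact: (smooth_on_flat (smooth_onD oT sq (smooth_on_cst (- (a + 1)) oT))).
have fg x : f x + g x != 0.
  rewrite gt_eqF //; have [h|h] := ltP (q x) (b + 1).
    by rewrite ltr_pwDl ?flat_ge0 // flat_gt0 //; lra.
  by rewrite ltr_wpDl ?flat_ge0 // flat_gt0 //; lra.
exists (fun x => f x * (f x + g x)^-1); split.
- exact: (smooth_onM oT sf (smooth_onV (smooth_onD oT sf sg) fg)).
- by move=> x; rewrite mulr_ge0 ?invr_ge0 ?addr_ge0 ?flat_ge0.
- move=> x h; have gx : g x = 0 by rewrite /g flat_le0 // qE; lra.
  by have := fg x; rewrite gx addr0 => fx; rewrite divff.
- by move=> x h; rewrite /f flat_le0 ?mul0r // qE; lra.
Qed.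

(** The inner radius is such that the Euclidean square is at most N r^2 / (4 (N + 1)^2) <= r^2 / 2,
    the inner threshold of the Euclidean cut-off. *)
Lemma bump_ball z (r : R) : 0 < r -> exists chi : 'rV[R]_N -> R,
  [/\ smooth_on setT chi, forall x, 0 <= chi x,
      forall x, `|x - z| <= r / (2 * (N%:R + 1)) -> chi x = 1 &
      forall x, r <= `|x - z| -> chi x = 0].
Proof.
move=> r0; have ab : r ^+ 2 / 2 < r ^+ 2 by have := exprn_gt0 2 r0; lra.
have [chi [s chi0 c1 c0]] := bump_dot z ab.
exists chi; split => // x h.
- apply: c1; apply: (le_trans (dot_le_norm_sqr _)).
  have n0 : 0 <= N%:R :> R by [].
  apply: (@le_trans _ _ (N%:R * (r / (2 * (N%:R + 1))) ^+ 2)).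
    by rewrite ler_wpM2l // lerXn2r ?nnegrE // divr_ge0 ?(ltW r0) //; lra.
  rewrite expr_div_n mulrCA ler_wpM2l ?sqr_ge0 //.
  have m0 : 0 < (2 * (N%:R + 1)) ^+ 2 :> R by apply: exprn_gt0; lra.
  by rewrite ler_pdivrMr //; nra.
- apply: c0; apply: (le_trans _ (norm_sqr_le_dot _)).
  by rewrite lerXn2r ?nnegrE // ltW.
Qed.

(** Bumps b_i over a finite cover are glued as 1 - prod (1 - b_i), one ball at a time by a + b - a
    b. The value 1 is attained on an open W, so that the cut-off changes no derivative there. *)
Lemma cutoff_compact (K V : set 'rV[R]_N) : compact K -> open V -> K `<=` V ->
  exists (chi : 'rV[R]_N -> R) (W C : set 'rV[R]_N),
  [/\ smooth_on setT chi, open W /\ closed C, K `<=` W /\ C `<=` V,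
      forall x, W x -> chi x = 1 & forall x, ~ C x -> chi x = 0].
Proof.
move=> cK oV KV.
have oT := @openT 'rV[R]_N.
have rad x : exists r : R, 0 < r /\ (V x -> forall y, `|y - x| <= r -> V y).
  have [Vx|nVx] := pselect (V x); last by exists 1; split.
  have /nbhs_ballP[r /= r0 h] : nbhs x V by exact: open_nbhs_nbhs.
  exists (r / 2); split; first by rewrite divr_gt0.
  move=> _ y yx; apply: h; rewrite -ball_normE /= distrC (le_lt_trans yx) //; lra.
have [r hr] := choice rad.
have r0 x : 0 < r x by have [] := hr x.
pose p x := r x / (2 * (N%:R + 1)).
have p0 x : 0 < p x.
  by rewrite divr_gt0 // mulr_gt0 // ltr_pwDr.
have := cK; rewrite compact_cover => /(_ _ K (fun z => [set x | `|x - z| < p z])) [].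
- move=> z _; have -> : [set x | `|x - z| < p z] = ball z (p z).
    by rewrite -ball_normE; apply/seteqP; split=> y /=; rewrite distrC.
  exact: ball_open.
- by move=> x Kx; exists x => //=; rewrite subrr normr0.
move=> D DK Kcov.
have key (s : seq 'rV[R]_N) : (forall z, z \in s -> V z) ->
    exists (chi : 'rV[R]_N -> R) (W C : set 'rV[R]_N),
  [/\ smooth_on setT chi, open W /\ closed C,
      (forall z, z \in s -> [set x | `|x - z| < p z] `<=` W) /\ C `<=` V,
      forall x, W x -> chi x = 1 & forall x, ~ C x -> chi x = 0]; last first.
  have [|chi [W [C [h1 h2 [h3 h3'] h4 h5]]]] := key (enum_fset D).
    by move=> z /DK /set_mem /KV.
  exists chi, W, C; split => //; split => //.
  by move=> x /Kcov[z /= zD xz]; apply: (h3 z).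
elim: s => [|z s IH] sV.
  exists (fun=> 0), set0, set0; split => //; first exact: smooth_on_cst.
    by split; [exact: open0|exact: closed0].
  by split.
have [|chi [W [C [h1 [h2 h2'] [h3 h3'] h4 h5]]]] := IH.
  by move=> y ys; apply: sV; rewrite inE ys orbT.
have Vz : V z by apply: sV; rewrite mem_head.
have [b [sb _ b1 b0]] := bump_ball z (r0 z).
exists (fun x => chi x + b x + -1 * (chi x * b x)), (W `|` [set x | `|x - z| < p z]),
  (C `|` [set x | `|x - z| <= r z]); split.
- exact: (smooth_onD oT (smooth_onD oT h1 sb) (smooth_onZ (-1) oT (smooth_onM oT h1 sb))).
- split.
    apply: openU => //; have -> : [set x | `|x - z| < p z] = ball z (p z).
      by rewrite -ball_normE; apply/seteqP; split=> y /=; rewrite distrC.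
    exact: ball_open.
  apply: closedU => //; have -> : [set x | `|x - z| <= r z] = closed_ball z (r z).
    by rewrite closed_ballE //; apply/seteqP; split=> y /=; rewrite /closed_ball_ /= distrC.
  exact: closed_ball_closed.
- split.
    by move=> y; rewrite inE => /orP[/eqP->|/h3 h] x xz; [right|left; exact: h].
  by move=> x [/h3'//|xz]; exact: (proj2 (hr z)).
- move=> x [Ox|xz]; first by rewrite h4 //; ring.
  by rewrite b1 ?ltW //; ring.
- move=> x nC; rewrite h5; last by move=> Cx; apply: nC; left.
  rewrite b0; first by ring.
  by rewrite leNgt; apply/negP => xz; apply: nC; right; exact: ltW.
Qed.

End Cutoffs.

(** * Taylor expansion and displacement of poles *)

Section Taylor.
Variable R : realType.

Lemma is_derive_affine (V : normedModType R) (f : V -> R) (a v : V) (t df : R) :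
  is_derive (a + t *: v) v f df -> is_derive t 1 (fun s : R => f (a + s *: v)) df.
Proof.
move/is_derive_line => h.
have ht : is_derive t 1 (fun s : R => s + - t) (1 + 0).
  exact: (is_derive_add (is_derive_id t 1) (is_derive_cst (- t) t 1)).
have h' : is_derive (t + - t) 1 (fun s : R => f (s *: v + (a + t *: v))) df by rewrite subrr.
have := is_derive_comp1 ht h'; rewrite addr0 mulr1.
by under eq_fun do rewrite scalerDl addrC -addrA [t *: v + _]addrC scaleNr addrNK.
Qed.

Lemma is_derive_powS (n : nat) (t : R) :
  is_derive t 1 (fun s : R => s ^+ n.+1) (n.+1%:R * t ^+ n).
Proof.
elim: n => [|n IH]; first by rewrite mul1r; exact: is_derive_id.
have h := is_derive_mul (is_derive_id t (1 : R)) IH.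
have -> : (fun s : R => s ^+ n.+2) = fun s => id s * s ^+ n.+1.
  by apply/funext => s; rewrite exprS.
by apply: (is_derive_eq h); rewrite /= -[in RHS]natr1 exprS; ring.
Qed.

Lemma deriv_ge0_le (f df : R -> R) (t : R) : 0 <= t ->
  (forall s : R, 0 <= s <= t -> is_derive s 1 f (df s)) ->
  (forall s : R, 0 <= s <= t -> 0 <= df s) -> f 0 <= f t.
Proof.
move=> t0 dfx df0.
have ct : {within `[0, t], continuous f}.
  apply: derivable_within_continuous => s; rewrite in_itv /= => st.
  by have [] := dfx s st.
have [s|c] := @MVT_segment _ f df 0 t t0 _ ct.
  by rewrite in_itv /= => /andP[s0 st]; apply: dfx; rewrite !ltW.
rewrite in_itv /= => ct' e; rewrite -subr_ge0 e mulr_ge0 ?subr_ge0 //.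
exact: df0.
Qed.

(** Induction on n for the shifted sequence: the bound on [g 1] is integrated through the
    monotonicity of M s^(n+1) / (n+1)! -+ (g 0 - Q). *)
Lemma taylor_bound (n : nat) (g : nat -> R -> R) (M : R) : 0 <= M ->
  (forall k (t : R), 0 <= t <= 1 -> is_derive t 1 (g k) (g k.+1 t)) ->
  (forall t : R, 0 <= t <= 1 -> `|g n t| <= M) ->
  forall t : R, 0 <= t <= 1 ->
  `|g 0 t - \sum_(i < n) g i 0 * t ^+ i / i`!%:R| <= M * t ^+ n / n`!%:R.
Proof.
move=> M0; elim: n g => [|n IH] g dg gM t t01.
  by rewrite big_ord0 subr0 fact0 expr0 mulr1 divr1; exact: gM.
have [t0 t1] := andP t01.
pose P (s : R) := \sum_(i < n) g i.+1 0 * s ^+ i / i`!%:R.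
pose Q (s : R) := \sum_(i < n.+1) g i 0 * s ^+ i / i`!%:R.
have fn0 k : (k`!%:R : R) != 0 by rewrite pnatr_eq0 -lt0n fact_gt0.
have dpow (c : R) (k : nat) (s : R) : is_derive s 1 (fun s : R => c * s ^+ k.+1 / (k.+1)`!%:R) (c * s ^+ k / k`!%:R).
  have h := is_derive_mul (is_derive_mul (is_derive_cst c s 1) (is_derive_powS k s))
    (is_derive_cst ((k.+1)`!%:R^-1 : R) s 1).
  apply: (is_derive_eq h); rewrite mulr0 addr0 mul0r add0r.
  rewrite /cst /= factS natrM.
  have : k.+1%:R != 0 :> R by rewrite pnatr_eq0.
  move: (fn0 k); move: (k`!%:R : R) (k.+1%:R : R) => a b a0 b0; field.
  by rewrite a0 b0.
have dQ (s : R) : is_derive s 1 Q (P s).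
  have -> : Q = fun s => g 0%N 0 + \sum_(i < n) g i.+1 0 * s ^+ i.+1 / (i.+1)`!%:R.
    by apply/funext => r; rewrite /Q big_ord_recl /= expr0 mulr1 fact0 divr1.
  have h := @is_derive_fsum R R _ (index_enum 'I_n) (fun i s => g i.+1 0 * s ^+ i.+1 / (i.+1)`!%:R)
    (fun i s => g i.+1 0 * s ^+ i / i`!%:R) s 1 (fun i => dpow (g i.+1 0) i s).
  by have := is_derive_add (is_derive_cst (g 0%N 0) s (1 : R)) h; rewrite add0r.
have IHs (s : R) : 0 <= s <= 1 -> `|g 1%N s - P s| <= M * s ^+ n / n`!%:R.
  exact: (IH (fun k => g k.+1)).
have Q0 : Q 0 = g 0%N 0.
  rewrite /Q big_ord_recl /= expr0 mulr1 fact0 divr1 big1 ?addr0 // => i _.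
  by rewrite /= /bump /= add1n exprS mul0r mulr0 mul0r.
have main (c : R) : (c = 1 \/ c = -1) ->
    c * (g 0%N t - Q t) <= M * t ^+ n.+1 / (n.+1)`!%:R.
  move=> hc.
  pose f (s : R) := M * s ^+ n.+1 / (n.+1)`!%:R + (- c) * (g 0%N s + -1 * Q s).
  have : f 0 <= f t.
    apply: (@deriv_ge0_le _ (fun s : R => M * s ^+ n / n`!%:R + (- c) * (g 1%N s - P s))) => // s.
    - move=> /andP[s0 st]; have s01 : 0 <= s <= 1 by rewrite s0 (le_trans st).
      have h := is_derive_mul (is_derive_cst (- c) s 1)
        (is_derive_add (dg 0%N s s01) (is_derive_mul (is_derive_cst (-1 : R) s 1) (dQ s))).
      by apply: (is_derive_eq (is_derive_add (dpow M n s) h)); rewrite /cst; ring.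
    - move=> /andP[s0 st]; have s01 : 0 <= s <= 1 by rewrite s0 (le_trans st).
      have := IHs s s01; rewrite ler_norml => /andP[h1 h2].
      by case: hc => ->; lra.
  rewrite /f Q0 exprS mul0r !mulr0 mul0r; lra.
have h1 := main 1 (or_introl erefl); have h2 := main (-1) (or_intror erefl).
by rewrite ler_norml -/(Q t); apply/andP; split; lra.
Qed.

End Taylor.

Section TaylorExpr.
Variables (R : realType) (N : nat).
Implicit Types (x v w z : 'rV[R]_N) (d : R) (e : expr R N).

Lemma eqv_eDs_iter d v s n e : eqv d (eDs s (iter n (eD v) e)) (iter n (eD v) (eDs s e)).
Proof.
elim: n => // n IH x s0; rewrite !iterS.
by rewrite -(eqv_eD_eDs _ _ _ s0) (eqv_eD v IH s0).
Qed.

(** The n! lost by n derivations cancels the 1/n! of the Taylor remainder, which leaves a geometric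
    error whose ratio does not depend on e. The cube of M is the degree gained in each
    derivation. *)
Lemma taylor_ev (r Q : R) e a v (n : nat) : 0 < r ->
  (forall t, 0 <= t <= 1 -> r <= sq 0 (a + t *: v) <= Q) ->
  `|ev 0 e (a + v) - \sum_(i < n) ev 0 (iter i (eD v) e) a / i`!%:R| <=
  enorm e * (2 * (Q + 2 + r^-1)) ^+ edeg e * (12 * norm1 v * (Q + 2 + r^-1) ^+ 3) ^+ n.
Proof.
move=> r0 h; set M := Q + 2 + r^-1.
have M1 : 1 <= M.
  have /andP[h1 h2] := h 0 (introT andP (conj (lexx 0) ler01)).
  have : 0 < r^-1 by rewrite invr_gt0.
  rewrite /M; lra.
have M0 : 0 <= M by lra.
have sp t : 0 <= t <= 1 -> 0 < sq 0 (a + t *: v).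
  by move=> /h/andP[h1 _]; exact: lt_le_trans h1.
pose g k t := ev 0 (iter k (eD v) e) (a + t *: v).
pose C := enorm (iter n (eD v) e) * M ^+ edeg (iter n (eD v) e).
have C0 : 0 <= C by rewrite mulr_ge0 ?enorm_ge0 // exprn_ge0.
have := @taylor_bound R n g C C0 _ _ 1; rewrite expr1n mulr1 ler01 lexx.
have -> : \sum_(i < n) g i 0 * 1 ^+ i / i`!%:R =
    \sum_(i < n) ev 0 (iter i (eD v) e) a / i`!%:R.
  by apply: eq_bigr => i _; rewrite /g scale0r addr0 expr1n mulr1.
have -> : g 0%N 1 = ev 0 e (a + v) by rewrite /g scale1r.
move=> tb; apply: (le_trans (tb _ _ isT)).
- by move=> k t t01; apply: is_derive_affine; apply: is_derive_ev; exact: sp.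
- by move=> t /h/andP[h1 h2]; exact: ev_bound.
have f0 : 0 < n`!%:R :> R by rewrite ltr0n fact_gt0.
rewrite ler_pdivrMr // /C.
have hd : M ^+ edeg (iter n (eD v) e) <= M ^+ (edeg e + 3 * n).
  by rewrite ler_weXn2l // edeg_iter_eD.
apply: (le_trans (ler_pM _ _ (enorm_iter_eD v n e) hd)).
- exact: enorm_ge0.
- exact: exprn_ge0.
rewrite exprD exprM [(2 * M) ^+ _]exprMn [(_ * M ^+ 3) ^+ n]exprMn le_eqVlt.
by apply/orP; left; apply/eqP; ring.
Qed.

End TaylorExpr.

(** * Approximable jets and admissible poles *)

Section Poles.
Variables (R : realType) (N : nat) (k : nat) (K Omega : set 'rV[R]_N).
Implicit Types (x v w z : 'rV[R]_N) (W : seq 'I_N -> 'I_N -> 'rV[R]_N -> R).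

(* W s j prescribes the partial derivative along s of the j-th component, so
   that limits and linear combinations can be formed derivative by derivative,
   without any smoothness of the limit. *)
Definition approximable W : Prop := forall eps : R, 0 < eps ->
  exists (ub : 'rV[R]_N -> 'rV[R]_N) (pb : 'rV[R]_N -> R),
  [/\ smooth_pair_on setT ub pb,
      exists r : R, forall x, r < `|x| -> ub x = 0 /\ pb x = 0,
      stokes_on Omega ub pb &
      forall s, (size s <= k)%N -> forall j x, K x ->
        `|dpart s (fun y => ub y 0 j) x - W s j x| <= eps].

Lemma approximable_lim W : (forall eps : R, 0 < eps -> exists2 W', approximable W' &
    forall s, (size s <= k)%N -> forall j x, K x -> `|W' s j x - W s j x| <= eps) ->
  approximable W.
Proof.
move=> h eps e0; have e20 : 0 < eps / 2 by rewrite divr_gt0.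
have [W' aW' hW'] := h _ e20; have [ub [pb [h1 h2 h3 h4]]] := aW' _ e20.
exists ub, pb; split => // s sk j x Kx.
have -> : dpart s (fun y => ub y 0 j) x - W s j x =
  (dpart s (fun y => ub y 0 j) x - W' s j x) + (W' s j x - W s j x) by ring.
by rewrite (le_trans (ler_normD _ _)) // [eps]splitr lerD // ?h4 ?hW'.
Qed.

Lemma approximable_ext W1 W2 : (forall s j x, K x -> W1 s j x = W2 s j x) ->
  approximable W1 -> approximable W2.
Proof.
move=> h a1; apply: approximable_lim => eps e0; exists W1 => // s _ j x Kx.
by rewrite h // subrr normr0 ltW.
Qed.

Lemma approximable0 : approximable (fun _ _ _ => 0).
Proof.
move=> eps e0; exists (fun=> 0), (fun=> 0); have oT := @openT 'rV[R]_N.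
have s0 := @smooth_on_cst R N setT 0 oT.
have d0 s x := @dpart_cst0 R N s x.
have c0 j : (fun y : 'rV[R]_N => (0 : 'rV[R]_N) 0 j) = fun=> 0.
  by apply/funext => y; rewrite mxE.
split.
- by split=> [j|]; [rewrite c0; exact: s0|exact: s0].
- by exists 0.
- split=> [x _ j|x _].
    by rewrite c0 d0 addr0 /laplacian big1 ?oppr0 // => i _; rewrite d0.
  by rewrite big1 // => i _; rewrite c0 d0.
- by move=> s _ j x _; rewrite c0 d0 subrr normr0 ltW.
Qed.

Lemma approximable_add W1 W2 (c : R) : open Omega ->
  approximable W1 -> approximable W2 ->
  approximable (fun s j x => W1 s j x + c * W2 s j x).
Proof.
move=> oO a1 a2 eps e0; have oT := @openT 'rV[R]_N.
have c1 : 0 < `|c| + 1 by have := normr_ge0 c; lra.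
have e1 : 0 < eps / 2 by rewrite divr_gt0.
have e2 : 0 < eps / 2 / (`|c| + 1) by rewrite divr_gt0.
have [u1 [p1 [[su1 sp1] [r1 b1] [m1 v1] k1]]] := a1 _ e1.
have [u2 [p2 [[su2 sp2] [r2 b2] [m2 v2] k2]]] := a2 _ e2.
pose ub x := u1 x + c *: u2 x; pose pb x := p1 x + c * p2 x.
have ubE j : (fun y => ub y 0 j) = fun y => u1 y 0 j + c * u2 y 0 j.
  by apply/funext => y; rewrite !mxE.
have dE s j x : dpart s (fun y => ub y 0 j) x =
    dpart s (fun y => u1 y 0 j) x + c * dpart s (fun y => u2 y 0 j) x.
  by rewrite ubE (dpartD s oT (su1 j) (smooth_onZ c oT (su2 j)) I) (dpartZ c s oT (su2 j) I).
have pE s x : dpart s pb x = dpart s p1 x + c * dpart s p2 x.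
  by rewrite (dpartD s oT sp1 (smooth_onZ c oT sp2) I) (dpartZ c s oT sp2 I).
exists ub, pb; split.
- split=> [j|].
    by rewrite ubE; exact: (smooth_onD oT (su1 j) (smooth_onZ c oT (su2 j))).
  exact: (smooth_onD oT sp1 (smooth_onZ c oT sp2)).
- exists (Num.max r1 r2) => x; rewrite gt_max => /andP[x1 x2].
  rewrite /ub /pb; have [-> ->] := b1 x x1; have [-> ->] := b2 x x2.
  by rewrite scaler0 mulr0 !addr0.
- split=> [x Ox j|x Ox].
    have E : laplacian (fun y => ub y 0 j) x = laplacian (fun y => u1 y 0 j) x
        + c * laplacian (fun y => u2 y 0 j) x.
      by rewrite /laplacian big_distrr -big_split; apply: eq_bigr => i _; rewrite dE.
    have := m1 x Ox j; have := m2 x Ox j; rewrite E pE => h2 h1.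
    rewrite opprD addrACA h1 add0r -mulrN -mulrDr h2 mulr0 //.
  have -> : \sum_(j < N) dpart [:: j] (fun y => ub y 0 j) x =
     \sum_(j < N) dpart [:: j] (fun y => u1 y 0 j) x +
     c * \sum_(j < N) dpart [:: j] (fun y => u2 y 0 j) x.
    by rewrite big_distrr -big_split; apply: eq_bigr => i _; rewrite dE.
  by rewrite v1 // v2 // mulr0 addr0.
- move=> s sk j x Kx; rewrite dE.
  have -> : forall a b a' b' : R, a + c * b - (a' + c * b') = (a - a') + c * (b - b').
    by move=> *; ring.
  rewrite (le_trans (ler_normD _ _)) // [eps]splitr lerD ?k1 // normrM.
  have := k2 s sk j x Kx; rewrite ler_pdivlMr // mulrDr mulr1 mulrC.
  have := normr_ge0 (dpart s (fun y => u2 y 0 j) x - W2 s j x); lra.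
Qed.

Lemma approximable_sum (I : Type) (r : seq I) (c : I -> R)
    (W : I -> seq 'I_N -> 'I_N -> 'rV[R]_N -> R) : open Omega ->
  (forall i, approximable (W i) \/ c i = 0) ->
  approximable (fun s j x => \sum_(i <- r) c i * W i s j x).
Proof.
move=> oO h; elim: r => [|i r IH].
  by apply: approximable_ext approximable0 => s j x _; rewrite big_nil.
have [a|ci] := h i.
  apply: approximable_ext (approximable_add (c i) oO IH a) => s j x _.
  by rewrite big_cons addrC.
by apply: approximable_ext IH => s j x _; rewrite big_cons ci mul0r add0r.
Qed.

Definition stokes_expr (E : 'I_N -> expr R N) (Q : expr R N) : Prop :=
  (forall j x, 0 < sq 0 x -> - ev 0 (lap (E j)) x + ev 0 (eD (ebasis R j) Q) x = 0) /\
  (forall x, 0 < sq 0 x -> \sum_j ev 0 (eD (ebasis R j) (E j)) x = 0).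

(** The system has constant coefficients, so it can be differentiated; [eqv_eD] applies to its two
    left-hand sides. *)
Lemma stokes_expr_eD v E Q : stokes_expr E Q -> stokes_expr (fun j => eD v (E j)) (eD v Q).
Proof.
move=> [m dv]; split=> [j x s0|x s0].
- have := @eqv_eD _ _ 0 v (Kadd (Kmul (Kcst N (-1)) (lap (E j))) (eD (ebasis R j) Q)) (Kcst N 0) _ x s0.
  rewrite [ev 0 (eD v (Kcst N 0)) x]/= => E0; rewrite -[RHS]E0 {E0}; last first.
    by move=> y sy /=; rewrite mulN1r; exact: m.
  rewrite /= mul0r add0r mulN1r (eqv_eD_lap _ _ s0); congr (_ + _).
  by rewrite ev_eD_comm.
- have := @eqv_eD _ _ 0 v (sume (index_enum 'I_N) (fun j => eD (ebasis R j) (E j))) (Kcst N 0) _ x s0.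
  rewrite [ev 0 (eD v (Kcst N 0)) x]/= => E0; rewrite -[RHS]E0 {E0}; last first.
    by move=> y sy /=; rewrite ev_sume; exact: dv.
  by rewrite eD_sume ev_sume; apply: eq_bigr => j _; rewrite ev_eD_comm.
Qed.

Lemma stokes_expr_iter v n E Q : stokes_expr E Q ->
  stokes_expr (fun j => iter n (eD v) (E j)) (iter n (eD v) Q).
Proof. by move=> h; elim: n => // n IH; exact: (stokes_expr_eD v IH). Qed.

Definition jet (E : 'I_N -> expr R N) z (s : seq 'I_N) (j : 'I_N) x : R :=
  ev 0 (eDs s (E j)) (x - z).

Lemma approximable_exterior E Q y : open Omega -> bounded_set Omega -> K `<=` Omega ->
  stokes_expr E Q -> interior (~` Omega) y -> approximable (jet E y).
Proof.
move=> oO bO KO [m dv] /nbhs_ballP[r /= r0 hr] eps e0.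
have [B1 B10 hB1] := bounded_set_norm bO.
pose B0 := B1 + 1; have B00 : 0 < B0 by rewrite /B0; lra.
have hB x : Omega x -> `|x| <= B0 by move=> /hB1 h; rewrite /B0; lra.
have oT := @openT 'rV[R]_N.
have [b [sb _ b1 b0]] := bump_ball y r0.
have n0 : 0 < 2 * (N%:R + 1) :> R by have := ler0n R N; lra.
have [c [sc _ c1 c0]] := @bump_ball R N 0 (B0 * (2 * (N%:R + 1))) (mulr_gt0 B00 n0).
(* chi = c (1 - b): c is 1 on Omega with bounded support, b is a bump in a ball around y that misses
   Omega. *)
pose chi x := c x + -1 * (c x * b x).
have schi : smooth_on setT chi.
  exact: (smooth_onD oT sc (smooth_onZ (-1) oT (smooth_onM oT sc sb))).
have chi1 x : Omega x -> chi x = 1.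
  move=> Ox; rewrite /chi c1; last by rewrite subr0 mulfK ?gt_eqF // hB.
  rewrite b0; first by ring.
  rewrite leNgt; apply/negP => xy; apply: (hr x) Ox; rewrite -ball_normE /=.
  by rewrite distrC.
have chi0 x : `|x - y| < r / (2 * (N%:R + 1)) -> chi x = 0.
  by move=> xy; rewrite /chi b1 ?ltW //; ring.
have Oreg x : Omega x -> regular_at 0 y x.
  move=> Ox; apply: sq_gt0_x; rewrite subr_eq0; apply/eqP => xy; subst x.
  by apply: (hr y) Ox; exact: ballxx.
(* At the pole [ev 0 e] has a mere default value, but the product is identically 0 on a ball around
   it. *)
have sm e : smooth_on setT (fun x => chi x * ev 0 e (x - y)).
  pose Bl := [set x : 'rV[R]_N | `|x - y| < r / (2 * (N%:R + 1))].
  have oB : open Bl.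
    have -> : Bl = ball y (r / (2 * (N%:R + 1))).
      by rewrite -ball_normE; apply/seteqP; split=> z /=; rewrite /Bl /= distrC.
    exact: ball_open.
  apply: (@smooth_on_sub _ _ (regular_at 0 y `|` Bl)).
    move=> x _; have [->|xy] := eqVneq x y.
      by right; rewrite /Bl /= subrr normr0 divr_gt0.
    by left; apply: sq_gt0_x; rewrite subr_eq0.
  apply: smooth_on_cup.
    apply: smooth_onM; [exact: open_regular| |exact: smooth_on_ev].
    exact: smooth_on_sub schi.
  apply: (smooth_on_near oB _ (smooth_on_cst 0 oB)) => x xB.
  by rewrite chi0 // mul0r.
pose ub x : 'rV[R]_N := \row_j (chi x * ev 0 (E j) (x - y)).
pose pb x := chi x * ev 0 Q (x - y).
have ubE j : (fun x => ub x 0 j) = fun x => chi x * ev 0 (E j) (x - y).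
  by apply/funext => x; rewrite mxE.
have dE e s x : Omega x -> dpart s (fun x => chi x * ev 0 e (x - y)) x = ev 0 (eDs s e) (x - y).
  move=> Ox; rewrite -dpart_ev; last exact: Oreg.
  by apply: (dpart_near _ oO) => // z Oz; rewrite chi1 // mul1r.
exists ub, pb; split.
- by split=> [j|]; rewrite ?ubE; exact: sm.
- exists (B0 * (2 * (N%:R + 1))) => x xb.
  have chix : chi x = 0 by rewrite /chi c0 ?subr0 ?ltW // mul0r mulr0 addr0.
  by rewrite /ub /pb chix mul0r; split=> //; apply/rowP => j; rewrite !mxE mul0r.
- split=> [x Ox j|x Ox].
    rewrite /laplacian ubE dE // -[RHS](m j (x - y) (Oreg _ Ox)); congr (- _ + _).
    by rewrite /lap ev_sume; apply: eq_bigr => i _; rewrite dE.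
  by rewrite -[RHS](dv (x - y) (Oreg _ Ox)); apply: eq_bigr => j _; rewrite ubE dE.
- by move=> s _ j x /KO Ox; rewrite ubE dE // subrr normr0 ltW.
Qed.

(** There are finitely many words of length at most k; constants that depend on the derivative
    become uniform. *)
Lemma bounded_words (F : seq 'I_N -> 'I_N -> R) : exists2 B : R, 0 <= B &
  forall s, (size s <= k)%N -> forall j, F s j <= B.
Proof.
exists (\sum_(s : k.-bseq 'I_N) \sum_j `|F s j|).
  by apply: sumr_ge0 => s _; exact: sumr_ge0.
move=> s sk j; rewrite (bigD1 (Bseq sk)) //= (bigD1 j) //=.
rewrite -addrA (le_trans (ler_norm _)) // lerDl addr_ge0 //.
  exact: sumr_ge0.
by apply: sumr_ge0 => t _; exact: sumr_ge0.
Qed.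

(** All Stokes expressions are included, so that the property also covers the Taylor coefficients
    with respect to the pole, which are derivatives of the given field. *)
Definition good_pole z : Prop :=
  forall E Q, stokes_expr E Q -> approximable (jet E z).

(** Since x - z' = (x - z) + v, the Taylor polynomials based at x - z are finite combinations of
    jets with pole z. A ratio of at most 1/2 makes them converge uniformly on K. *)
Lemma good_pole_move z z' (r q : R) : open Omega -> 0 < r ->
  (forall x, K x -> forall t, 0 <= t <= 1 -> r <= sq 0 (x - z + t *: (z - z')) <= q) ->
  12 * norm1 (z - z') * (q + 2 + r^-1) ^+ 3 <= 1 / 2 ->
  good_pole z -> good_pole z'.
Proof.
move=> oO r0 hK small gz E Q sE; set v := z - z' in hK small.
apply: approximable_lim => eps e0.
have [B B0 hB] := bounded_words (fun s j => enorm (eDs s (E j)) *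
  (2 * (q + 2 + r^-1)) ^+ edeg (eDs s (E j))).
have [n hn] : exists n : nat, B * (1 / 2) ^+ n <= eps.
  have [->|Bn0] := eqVneq B 0; first by exists 0%N; rewrite mul0r ltW.
  have Bp : 0 < B by rewrite lt_def Bn0.
  have : (fun n => (1 / 2 : R) ^+ n) @ \oo --> (0 : R).
    by apply: cvg_expr; rewrite ger0_norm; lra.
  move/cvgr0Pnorm_le => /(_ (eps / B)) [|n _ /(_ n (leqnn n)) h]; first by rewrite divr_gt0.
  exists n; rewrite mulrC -ler_pdivlMr //; apply: le_trans h; exact: ler_norm.
exists (fun s j x => \sum_(i <- index_enum 'I_n) (i`!%:R)^-1 * jet (fun j => iter i (eD v) (E j)) z s j x).
  by apply: approximable_sum => // i; left; apply: gz; exact: stokes_expr_iter sE.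
move=> s sk j x Kx; rewrite distrC.
have sp : 0 < sq 0 (x - z).
  have := hK x Kx 0; rewrite lexx ler01 scale0r addr0 => /(_ isT)/andP[h _].
  exact: lt_le_trans h.
have -> : \sum_(i <- index_enum 'I_n) (i`!%:R)^-1 * jet (fun j => iter i (eD v) (E j)) z s j x =
    \sum_(i < n) ev 0 (iter i (eD v) (eDs s (E j))) (x - z) / i`!%:R.
  by apply: eq_bigr => i _; rewrite mulrC /jet (eqv_eDs_iter _ _ _ _ sp).
have -> : jet E z' s j x = ev 0 (eDs s (E j)) (x - z + v).
  by rewrite /jet /v addrA subrK.
apply: (le_trans (taylor_ev _ _ r0 (hK x Kx))).
have M0 : 0 <= q + 2 + r^-1.
  have /andP[h1 h2] := hK x Kx 0 (introT andP (conj (lexx 0) ler01)).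
  by rewrite !addr_ge0 ?invr_ge0 ?(ltW r0) // (le_trans (ltW r0)) // (le_trans h1).
have S0 : 0 <= 12 * norm1 v * (q + 2 + r^-1) ^+ 3.
  by apply: mulr_ge0; [apply: mulr_ge0 => //; exact: norm1_ge0|exact: exprn_ge0].
apply: le_trans hn; apply: ler_pM; first 2 last.
- exact: hB.
- by rewrite lerXn2r // nnegrE; lra.
- by apply: mulr_ge0; [exact: enorm_ge0|apply: exprn_ge0; exact: mulr_ge0].
- exact: exprn_ge0.
Qed.

Lemma norm1_le v : norm1 v <= N%:R * `|v|.
Proof.
rewrite /norm1 (@le_trans _ _ (\sum_(i < N) `|v|)) //; last first.
  by rewrite sumr_const card_ord mulr_natl.
by apply: ler_sum => i _; exact: coord_le_norm.
Qed.

(** Symmetry in z and z' is the point: z = z0 gives openness of the set of good poles, z' = z0 gives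
    closedness. *)
Lemma good_pole_local z0 : open Omega -> compact K -> ~ K z0 ->
  exists2 rho : R, 0 < rho & forall z z', `|z0 - z| < rho -> `|z0 - z'| < rho ->
    good_pole z -> good_pole z'.
Proof.
move=> oO cK nK.
have clK : closed K by apply: compact_closed => //; exact: norm_hausdorff.
have [B B0 hB] := bounded_set_norm (compact_bounded cK).
have [r0 r00 hr0] : exists2 r0 : R, 0 < r0 & forall x, K x -> r0 <= `|x - z0|.
  have /nbhs_ballP[e /= e0 he] : nbhs z0 (~` K).
    by apply: open_nbhs_nbhs; split => //; exact: closed_openC.
  exists e => // x Kx; rewrite leNgt; apply/negP => xz.
  by apply: (he x) Kx; rewrite -ball_normE /= distrC.
pose r := (r0 / 2) ^+ 2; pose q := N%:R * (B + `|z0| + r0) ^+ 2.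
have rp : 0 < r by rewrite exprn_gt0 // divr_gt0.
have q0 : 0 <= q by rewrite mulr_ge0 // sqr_ge0.
pose M := q + 2 + r^-1.
have ri : 0 < r^-1 by rewrite invr_gt0.
have Mp : 0 < M by rewrite /M; lra.
(* Since |z - z'| <= 2 / D, the Taylor ratio is at most 12 N (2 / D) M^3 = N / (2 (N + 1)) <=
   1/2. *)
pose D := 48 * (N%:R + 1) * M ^+ 3.
have Np : 0 < N%:R + 1 :> R by have := ler0n R N; lra.
have Dp : 0 < D by rewrite mulr_gt0 ?exprn_gt0 // mulr_gt0.
exists (Num.min (r0 / 2) D^-1) => [|z z'].
  by rewrite lt_min divr_gt0 //= invr_gt0.
rewrite !lt_min => /andP[z1 z2] /andP[z1' z2'].
apply: (@good_pole_move z z' r q) => // [x Kx t /andP[t0 t1]|]; last first.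
  have h : `|z - z'| <= D^-1 + D^-1.
    by rewrite (le_trans (ler_distD z0 _ _)) // lerD // ltW // distrC.
  have h1 := le_trans (norm1_le (z - z')) (ler_wpM2l (ler0n R N) h).
  apply: (@le_trans _ _ (12 * (N%:R * (D^-1 + D^-1)) * M ^+ 3)).
    by rewrite ler_wpM2r ?exprn_ge0 ?(ltW Mp) // ler_wpM2l.
  have M3 : 0 < M ^+ 3 by rewrite exprn_gt0.
  have -> : 12 * (N%:R * (D^-1 + D^-1)) * M ^+ 3 = 1 / 2 * (N%:R / (N%:R + 1)).
    rewrite /D; move: (M ^+ 3) M3 Np => m m0; move: (N%:R : R) => n n0; field.
    by rewrite !gt_eqF.
  rewrite -[X in _ <= X]mulr1 ler_wpM2l ?divr_ge0 //.
  by rewrite ler_pdivrMr // mul1r lerDl.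
set y := x - z + _.
(* A convex combination of z0 - z and z0 - z': the whole segment stays within r0 / 2 of x - z0. *)
have yE : y = (x - z0) + ((1 - t) *: (z0 - z) + t *: (z0 - z')).
  by apply/rowP => i; rewrite !mxE; ring.
have h : `|(1 - t) *: (z0 - z) + t *: (z0 - z')| <= r0 / 2.
  rewrite (le_trans (ler_normD _ _)) // !normrZ !ger0_norm ?subr_ge0 //.
  have := ltW z1; have := ltW z1'; nra.
have ylo : r0 / 2 <= `|y|.
  have := hr0 x Kx; have := lerB_normD (x - z0) ((1 - t) *: (z0 - z) + t *: (z0 - z')).
  rewrite -yE; lra.
have yhi : `|y| <= B + `|z0| + r0.
  rewrite yE (le_trans (ler_normD _ _)) // lerD //; last by rewrite (le_trans h) //; lra.
  by rewrite (le_trans (ler_normB _ _)) // lerD2r hB.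
rewrite /sq expr0n addr0; apply/andP; split.
  by apply: le_trans (norm_sqr_le_dot _); rewrite lerXn2r ?nnegrE // divr_ge0 // ltW.
apply: (le_trans (dot_le_norm_sqr _)); rewrite ler_wpM2l // lerXn2r ?nnegrE //.
by rewrite (le_trans _ yhi).
Qed.

Lemma good_pole_all z : open Omega -> bounded_set Omega -> K `<=` Omega -> compact K ->
  (forall x, (~` K) x ->
     exists y, connected_component (~` K) x y /\ interior (~` Omega) y) ->
  ~ K z -> good_pole z.
Proof.
move=> oO bO KO cK hcomp nKz.
have [y [zy iy]] := hcomp z nKz.
pose A := connected_component (~` K) z.
pose Z := [set x | ~ K x /\ good_pole x].
have AK x : A x -> ~ K x by move=> /connected_component_sub.
have cA : connected A by exact: component_connected.
suff : A `&` Z = A.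
  by move=> E; have [_ []] : (A `&` Z) z by rewrite E; exact: connected_component_refl.
have clK : closed K by apply: compact_closed => //; exact: norm_hausdorff.
apply: cA.
- exists y; split => //; split; first exact: AK.
  by move=> E Q sE; exact: (approximable_exterior oO bO KO sE iy).
- exists Z => //; rewrite openE => x [nK gx].
  have [rho rho0 h] := good_pole_local oO cK nK.
  have nb : nbhs x (~` K) by apply: open_nbhs_nbhs; split => //; exact: closed_openC.
  apply/nbhs_ballP; have /nbhs_ballP[e /= e0 he] := nb.
  exists (Num.min e rho) => /=; first by rewrite lt_min e0.
  move=> x'; rewrite -ball_normE /= lt_min => /andP[h1 h2]; split.
    by apply: he; rewrite -ball_normE.
  by apply: (h x) => //; rewrite subrr normr0.
- exists (closure Z); first exact: closed_closure.
  apply/seteqP; split=> x [Ax Zx]; split => //; first exact: subset_closure.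
  have nK := AK x Ax; split => //.
  have [rho rho0 h] := good_pole_local oO cK nK.
  have [x' [[_ gx'] xx']] := Zx _ (nbhsx_ballx x rho rho0).
  rewrite -ball_normE /= in xx'.
  by apply: (h x') => //; rewrite subrr normr0.
Qed.

End Poles.

(** * Test functions and lattice sums *)

Section MeanValue.
Variables (R : realType) (N : nat).

Lemma lipschitz1 (g dg : R -> R) (C a b : R) :
  (forall t, Num.min a b <= t <= Num.max a b -> is_derive t 1 g (dg t)) ->
  (forall t, Num.min a b <= t <= Num.max a b -> `|dg t| <= C) ->
  `|g b - g a| <= C * `|b - a|.
Proof.
wlog ab : a b / a <= b.
  move=> hw; have [ab|ba] := orP (le_total a b); first exact: hw.
  rewrite minC maxC => h1 h2; rewrite distrC [X in _ <= _ * X]distrC.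
  exact: (hw b a ba).
rewrite min_l // max_r // => hd hC.
have ct : {within `[a, b], continuous g}.
  apply: derivable_within_continuous => s; rewrite in_itv /= => st.
  by have [] := hd s st.
have [s|c] := @MVT_segment _ g dg a b ab _ ct.
  by rewrite in_itv /= => /andP[s0 st]; apply: hd; rewrite !ltW.
by rewrite in_itv /= => ct' ->; rewrite normrM ler_wpM2r // hC.
Qed.

(** A path from x to y that changes one coordinate at a time stays in the ball, because the norm is
    the maximum norm; partial derivatives alone give the estimate. *)
Lemma lipschitz_box (f : 'rV[R]_N -> R) (df : 'I_N -> 'rV[R]_N -> R) (C r : R) :
  (forall x, `|x| <= r -> forall i, is_derive x (ebasis R i) f (df i x)) ->
  (forall x, `|x| <= r -> forall i, `|df i x| <= C) ->
  forall x y, `|x| <= r -> `|y| <= r -> `|f y - f x| <= N%:R * C * `|y - x|.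
Proof.
move=> hd hC x y xr yr.
have r0 : 0 <= r := le_trans (normr_ge0 _) xr.
pose mix (k : nat) : 'rV[R]_N := \row_j (if (j < k)%N then y 0 j else x 0 j).
have mix0 : mix 0%N = x by apply/rowP => j; rewrite mxE.
have mixN : mix N = y by apply/rowP => j; rewrite mxE ltn_ord.
have -> : f y - f x = \sum_(k < N) (f (mix k.+1) - f (mix k)).
  rewrite -(big_mkord xpredT (fun k => f (mix k.+1) - f (mix k))).
  by rewrite telescope_sumr // mixN mix0.
apply: (le_trans (ler_norm_sum _ _ _)).
apply: (@le_trans _ _ (\sum_(k < N) C * `|y - x|)); last first.
  by rewrite sumr_const card_ord mulr_natl -mulrnAl.
apply: ler_sum => k _.
have mixS : mix k.+1 = mix k + (y 0 k - x 0 k) *: ebasis R k.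
  apply/rowP => j; rewrite !mxE eqxx /= ltnS leq_eqVlt -(inj_eq val_inj) /=.
  have [e|ne] := eqVneq (val j) (val k).
    by rewrite (val_inj e) ltnn mulr1 addrC subrK.
  by rewrite mulr0 addr0.
have mixt t : Num.min 0 (y 0 k - x 0 k) <= t <= Num.max 0 (y 0 k - x 0 k) ->
    `|mix k + t *: ebasis R k| <= r.
  move=> ht; apply: norm_le_coord => // j; rewrite !mxE eqxx /=.
  have yj := le_trans (coord_le_norm y j) yr; have xj := le_trans (coord_le_norm x j) xr.
  have [e|ne] := eqVneq j k; last by rewrite mulr0 addr0; case: ifP.
  subst j; rewrite ltnn mulr1; move: ht; move: yj xj; rewrite !ler_norml.
  move=> /andP[a1 a2] /andP[b1 b2].
  by rewrite minEle maxEle; case: ifP => c /andP[c1 c2]; apply/andP; split; lra.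
have := @lipschitz1 (fun t => f (mix k + t *: ebasis R k))
  (fun t => df k (mix k + t *: ebasis R k)) C 0 (y 0 k - x 0 k).
rewrite scale0r addr0 -mixS subr0 => h.
apply: (le_trans (h _ _)).
- by move=> t ht; apply: is_derive_affine; apply: hd; exact: mixt.
- by move=> t ht; apply: hC; exact: mixt.
have C0 : 0 <= C by apply: (le_trans (normr_ge0 _)); apply: (hC x xr k).
by rewrite ler_wpM2l //; have := coord_le_norm (y - x) k; rewrite !mxE.
Qed.

End MeanValue.

Section TestFunctions.
Variables (R : realType) (N : nat).
Implicit Types (x y : 'rV[R]_N) (psi : 'rV[R]_N -> R) (r : R).

Definition testf r psi : Prop :=
  smooth_on setT psi /\ forall y, r < `|y| -> psi y = 0.

Lemma open_norm_gt r : open [set y : 'rV[R]_N | r < `|y|].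
Proof.
have -> : [set y : 'rV[R]_N | r < `|y|] = (fun y => `|y|) @^-1` [set t | r < t] by [].
by apply: open_comp; [move=> y _; exact: norm_continuous|exact: open_gt].
Qed.

Lemma testf_dpart r psi s : testf r psi -> testf r (dpart s psi).
Proof.
move=> [sp p0]; split; first exact: smooth_on_dpart.
move=> y ry; rewrite -[RHS](@dpart_cst0 R N s y).
by apply: (dpart_near _ (@open_norm_gt r)) => // z; exact: p0.
Qed.

Lemma testfD r psi phi : testf r psi -> testf r phi -> testf r (fun y => psi y + phi y).
Proof.
move=> [s1 h1] [s2 h2]; split; first exact: (smooth_onD openT s1 s2).
by move=> y ry; rewrite h1 // h2 // addr0.
Qed.

Lemma testfN r psi : testf r psi -> testf r (fun y => - psi y).
Proof.
move=> [s1 h1]; split; first exact: (smooth_onN openT s1).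
by move=> y ry; rewrite h1 // oppr0.
Qed.

Lemma testf_sum r (I : Type) (s : seq I) (F : I -> 'rV[R]_N -> R) :
  (forall i, testf r (F i)) -> testf r (fun y => \sum_(i <- s) F i y).
Proof.
move=> h; split; first by apply: smooth_on_sum => [|i]; [exact: openT|have [] := h i].
by move=> y ry; rewrite big1 // => i _; have [_ ->] := h i.
Qed.

Lemma testf_bounded r psi : testf r psi -> exists2 B : R, 0 <= B & forall y, `|psi y| <= B.
Proof.
move=> [sp p0].
have cB : compact [set y : 'rV[R]_N | `|y| <= r].
  apply: bounded_closed_compact.
    by exists r; split; [exact: num_real|move=> M rM y /= yr; exact: le_trans yr (ltW rM)].
  have -> : [set y : 'rV[R]_N | `|y| <= r] = (fun y => `|y|) @^-1` [set t | t <= r] by [].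
  by apply: closed_comp; [move=> y _; exact: norm_continuous|exact: closed_le].
have cp : continuous psi by move=> y; have [] := sp [::] y I.
have := compact_bounded (continuous_compact (continuous_subspaceT cp) cB).
move=> [M [_ hM]]; exists (`|M| + 1); first by have := normr_ge0 M; lra.
move=> y; have [yr|ry] := leP (`|y|) r.
  by apply: hM; [have := ler_norm M; lra|exists y].
by rewrite p0 // normr0; have := normr_ge0 M; lra.
Qed.

Lemma testf_lipschitz r psi : testf r psi -> exists2 C : R, 0 <= C &
  forall x y, `|psi y - psi x| <= C * `|y - x|.
Proof.
move=> tp.
have /choice[B hB] i : exists B : R, forall y, `|dpart [:: i] psi y| <= B.
  by have [B _ h] := testf_bounded (testf_dpart [:: i] tp); exists B.
pose C := \sum_i B i.
have B0 i : 0 <= B i.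
  exact: le_trans (normr_ge0 _) (hB i 0).
have C0 : 0 <= C by exact: sumr_ge0.
exists (N%:R * C) => [|x y]; first exact: mulr_ge0.
apply: (@lipschitz_box _ _ psi (fun i => dpart [:: i] psi) C (`|x| + `|y|)).
- by move=> z _ i; exact: (smooth_onP [::] i (proj1 tp) (I : setT z)).
- move=> z _ i; apply: (le_trans (hB i z)).
  by rewrite /C (bigD1 i) //= lerDl sumr_ge0.
- by rewrite lerDl.
- by rewrite lerDr.
Qed.

End TestFunctions.

(** * Riemann sums on a cubic lattice *)

Section Lattice.
Variables (R : realType) (N : nat) (L : nat).
Implicit Types (x y : 'rV[R]_N) (g psi : 'rV[R]_N -> R) (n : nat).

(** Indexes the points of mesh 1/n in the half-open cube [-L, L)^N; as a finite function type it
    allows cyclic reindexing and the exchange of products and sums. *)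
Definition lattice n := {ffun 'I_N -> 'I_(2 * L * n)}.

Definition lpt n (z : lattice n) : 'rV[R]_N := \row_i ((z i)%:R / n%:R - L%:R).

Definition lsum n g : R := n%:R^-1 ^+ N * \sum_(z : lattice n) g (lpt z).

Lemma lsumD n g1 g2 : lsum n (fun y => g1 y + g2 y) = lsum n g1 + lsum n g2.
Proof. by rewrite /lsum big_split mulrDr. Qed.

Lemma lsumZ n (c : R) g : lsum n (fun y => c * g y) = c * lsum n g.
Proof. by rewrite /lsum -big_distrr mulrCA. Qed.

Lemma lsumN n g : lsum n (fun y => - g y) = - lsum n g.
Proof. by rewrite /lsum sumrN mulrN. Qed.

Lemma lsum_sum n (I : Type) (r : seq I) (F : I -> 'rV[R]_N -> R) :
  lsum n (fun y => \sum_(i <- r) F i y) = \sum_(i <- r) lsum n (F i).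
Proof. by rewrite /lsum exchange_big big_distrr. Qed.

Lemma eq_lsum n g1 g2 : (forall y, g1 y = g2 y) -> lsum n g1 = lsum n g2.
Proof. by move=> h; rewrite /lsum; congr (_ * _); apply: eq_bigr. Qed.

Lemma ler_lsum n g1 g2 : (forall y, g1 y <= g2 y) -> lsum n g1 <= lsum n g2.
Proof.
by move=> h; rewrite /lsum ler_wpM2l ?exprn_ge0 ?invr_ge0 // ler_sum.
Qed.

Lemma ler_norm_lsum n g : `|lsum n g| <= lsum n (fun y => `|g y|).
Proof.
rewrite /lsum normrM ger0_norm ?exprn_ge0 ?invr_ge0 //.
by rewrite ler_wpM2l ?exprn_ge0 ?invr_ge0 // ler_norm_sum.
Qed.

Lemma lsum_cst n (c : R) : (0 < n)%N -> lsum n (fun=> c) = (2 * L%:R) ^+ N * c.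
Proof.
move=> n0; rewrite /lsum sumr_const card_ffun !card_ord -[c *+ _]mulr_natr natrX !natrM.
have nn0 : n%:R ^+ N != 0 :> R by rewrite expf_neq0 // pnatr_eq0 -lt0n.
rewrite [(_ * n%:R) ^+ N]exprMn exprVn; move: (n%:R ^+ N) nn0 => b b0.
by field.
Qed.

Lemma lsum_bound n g (B : R) : (0 < n)%N -> (forall y, `|g y| <= B) ->
  `|lsum n g| <= (2 * L%:R) ^+ N * B.
Proof.
move=> n0 h; apply: (le_trans (ler_norm_lsum _ _)).
by rewrite -(lsum_cst B n0); exact: ler_lsum.
Qed.

Lemma lsum_shift n i g : (0 < n)%N -> (forall y, L%:R <= `|y| -> g y = 0) ->
  lsum n (fun y => g (y + n%:R^-1 *: ebasis R i)) = lsum n g.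
Proof.
move=> n0 g0; rewrite /lsum; congr (_ * _).
have nn0 : n%:R != 0 :> R by rewrite pnatr_eq0 -lt0n.
pose sh (z : lattice n) : lattice n := [ffun j => if j == i then ordS (z j) else z j].
have shI : injective sh.
  move=> z1 z2 /ffunP e; apply/ffunP => j; have := e j; rewrite !ffunE.
  by case: eqP => // _ /ordS_inj.
rewrite [RHS](reindex_inj shI) /=; apply: eq_bigr => z _.
(* The cyclic shift is the translation except on the last layer of the box, where
   both terms vanish. *)
have [lt|ge] := ltnP (z i).+1 (2 * L * n).
  congr g; apply/rowP => j; rewrite !mxE ffunE eqxx /=.
  have [->|ne] := eqVneq j i.
    by rewrite /= modn_small // -[(z i).+1%:R]natr1 mulrDl mulr1 mul1r addrAC.
  by rewrite mulr0 addr0.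
have zE : (z i).+1 = (2 * L * n)%N by apply/eqP; rewrite eqn_leq ge ltn_ord.
rewrite !g0 //.
- apply: le_trans (coord_le_norm _ i); rewrite !mxE ffunE eqxx /=.
  by rewrite zE modnn mul0r sub0r normrN ger0_norm.
- apply: le_trans (coord_le_norm _ i); rewrite !mxE !eqxx /= mulr1.
  rewrite addrAC -{2}[n%:R^-1]mul1r -mulrDl natr1 zE !natrM mulfK //.
  by rewrite [2 * _]mulr_natl mulr2n addrK ger0_norm.
Qed.

(* g1 differs by O(1/n) from a difference quotient of g, whose lattice sum is zero
   by translation invariance. *)
Lemma lsum_deriv n i g g1 g2 (C : R) : (0 < n)%N -> 0 <= C ->
  (forall y, L%:R <= `|y| -> g y = 0) ->
  (forall y, is_derive y (ebasis R i) g (g1 y)) ->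
  (forall y, is_derive y (ebasis R i) g1 (g2 y)) ->
  (forall y, `|g2 y| <= C) ->
  `|lsum n g1| <= (2 * L%:R) ^+ N * (C / n%:R).
Proof.
move=> n0 C0 g0 dg dg1 g2C.
have np : 0 < n%:R :> R by rewrite ltr0n.
pose e := ebasis R i.
have -> : lsum n g1 = lsum n (fun y => g1 y + - (n%:R * (g (y + n%:R^-1 *: e) + - g y))).
  rewrite lsumD lsumN lsumZ lsumD lsumN lsum_shift // subrr mulr0 oppr0 addr0 //.
apply: lsum_bound => // y.
(* The derivative of G is at most C/n on [0, 1/n], so G varies there by at most C/n^2, and the
   factor n of the difference quotient leaves C/n. *)
pose G (t : R) := g (y + t *: e) - t * g1 y.
have dG (t : R) : is_derive t 1 G (g1 (y + t *: e) - g1 y).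
  have h := is_derive_add (is_derive_affine (dg (y + t *: e)))
    (is_derive_mul (is_derive_cst (-1 : R) t 1)
      (is_derive_mul (is_derive_id t (1 : R)) (is_derive_cst (g1 y) t 1))).
  have -> : G = fun t => g (y + t *: e) + -1 * (t * g1 y).
    by apply/funext => s; rewrite mulN1r.
  by apply: (is_derive_eq h); rewrite /cst /= -/e; ring.
have hpos : 0 <= n%:R^-1 :> R by rewrite invr_ge0.
have := @lipschitz1 R G (fun t => g1 (y + t *: e) - g1 y) (C / n%:R) 0 n%:R^-1
  (fun t _ => dG t).
rewrite min_l // max_r // subr0 /G scale0r addr0 mul0r subr0 => h.
have h2 : forall t, 0 <= t <= n%:R^-1 -> `|g1 (y + t *: e) - g1 y| <= C / n%:R.
  move=> t /andP[t0 t1].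
  have := @lipschitz1 R (fun t => g1 (y + t *: e)) (fun t => g2 (y + t *: e)) C 0 t
    (fun t _ => is_derive_affine (dg1 (y + t *: e))) (fun t _ => g2C _).
  rewrite scale0r addr0 subr0 => h3; apply: (le_trans h3).
  by rewrite ger0_norm // ler_wpM2l.
have := h h2; rewrite (ger0_norm hpos) => h4.
have -> : g1 y + - (n%:R * (g (y + n%:R^-1 *: e) + - g y)) =
   - (n%:R * (g (y + n%:R^-1 *: e) - n%:R^-1 * g1 y - g y)).
  by rewrite !mulrBr mulrA mulfV ?gt_eqF //; ring.
by rewrite normrN normrM (ger0_norm (ltW np)) -ler_pdivlMl // [X in _ <= X]mulrC.
Qed.

End Lattice.

(** * Lattice convolution and summation by parts *)

Section Convolution.
Variables (R : realType) (N : nat) (L : nat).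
Implicit Types (d : R) (x y : 'rV[R]_N) (psi : 'rV[R]_N -> R) (n : nat) (e : expr R N).

Definition conv d n e psi x : R := lsum L n (fun y => ev d e (x - y) * psi y).

Lemma convDl d n e1 e2 psi x : conv d n (Kadd e1 e2) psi x = conv d n e1 psi x + conv d n e2 psi x.
Proof. by rewrite /conv -lsumD; apply: eq_lsum => y /=; rewrite mulrDl. Qed.

Lemma convZl d n (c : R) e psi x : conv d n (Kmul (Kcst N c) e) psi x = c * conv d n e psi x.
Proof. by rewrite /conv -lsumZ; apply: eq_lsum => y /=; rewrite mulrA. Qed.

Lemma conv_suml d n (I : Type) (r : seq I) (F : I -> expr R N) psi x :
  conv d n (sume r F) psi x = \sum_(i <- r) conv d n (F i) psi x.
Proof.
rewrite /conv -lsum_sum; apply: eq_lsum => y.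
by rewrite ev_sume big_distrl.
Qed.

Lemma convDr d n e psi phi x :
  conv d n e (fun y => psi y + phi y) x = conv d n e psi x + conv d n e phi x.
Proof. by rewrite /conv -lsumD; apply: eq_lsum => y; rewrite mulrDr. Qed.

Lemma convNr d n e psi x : conv d n e (fun y => - psi y) x = - conv d n e psi x.
Proof. by rewrite /conv -lsumN; apply: eq_lsum => y; rewrite mulrN. Qed.

Lemma conv_sumr d n e (I : Type) (r : seq I) (F : I -> 'rV[R]_N -> R) x :
  conv d n e (fun y => \sum_(i <- r) F i y) x = \sum_(i <- r) conv d n e (F i) x.
Proof. by rewrite /conv -lsum_sum; apply: eq_lsum => y; rewrite big_distrr. Qed.

Lemma eqv_conv d n e1 e2 psi x : d != 0 -> eqv d e1 e2 -> conv d n e1 psi x = conv d n e2 psi x.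
Proof. by move=> d0 h; apply: eq_lsum => y; rewrite h // sq_gt0. Qed.

(* 1/n is the mesh of the lattice. *)
Definition asym (X : R) (F G : nat -> 'rV[R]_N -> R) : Prop :=
  exists C : R, 0 <= C /\ forall n x, (0 < n)%N -> `|x| <= X -> `|F n x - G n x| <= C / n%:R.

Lemma asym_refl X F : asym X F F.
Proof. by exists 0; split=> // n x _ _; rewrite subrr normr0 mul0r. Qed.

Lemma asym_trans X F G H : asym X F G -> asym X G H -> asym X F H.
Proof.
move=> [C1 [C10 h1]] [C2 [C20 h2]]; exists (C1 + C2); split; first exact: addr_ge0.
move=> n x n0 xX; rewrite -(subrKA (G n x)) mulrDl (le_trans (ler_normD _ _)) //.
by rewrite lerD ?h1 ?h2.
Qed.

Lemma asym_sym X F G : asym X F G -> asym X G F.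
Proof.
by move=> [C [C0 h]]; exists C; split=> // n x n0 xX; rewrite distrC h.
Qed.

Lemma asymD X F G F' G' : asym X F G -> asym X F' G' ->
  asym X (fun n x => F n x + F' n x) (fun n x => G n x + G' n x).
Proof.
move=> [C1 [C10 h1]] [C2 [C20 h2]]; exists (C1 + C2); split; first exact: addr_ge0.
move=> n x n0 xX; rewrite opprD addrACA mulrDl (le_trans (ler_normD _ _)) //.
by rewrite lerD ?h1 ?h2.
Qed.

Lemma asymN X F G : asym X F G -> asym X (fun n x => - F n x) (fun n x => - G n x).
Proof.
move=> [C [C0 h]]; exists C; split=> // n x n0 xX.
by rewrite -opprD normrN h.
Qed.

Lemma asym_sum X (I : Type) (r : seq I) (F G : I -> nat -> 'rV[R]_N -> R) :
  (forall i, asym X (F i) (G i)) ->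
  asym X (fun n x => \sum_(i <- r) F i n x) (fun n x => \sum_(i <- r) G i n x).
Proof.
move=> h; elim: r => [|i r IH].
  by exists 0; split=> // n x _ _; rewrite !big_nil subrr normr0 mul0r.
have [C [C0 hC]] := asymD (h i) IH.
by exists C; split=> // n x n0 xX; rewrite !big_cons; exact: hC.
Qed.

Lemma asym_eq X F G F' G' : (forall n x, F n x = F' n x) -> (forall n x, G n x = G' n x) ->
  asym X F G -> asym X F' G'.
Proof.
by move=> hF hG [C [C0 h]]; exists C; split=> // n x n0 xX; rewrite -hF -hG h.
Qed.

Variables (r : R) (rL : r < L%:R) (X : R).

(** [lsum_deriv] for the product of the kernel at x - y with psi(y): differentiation in y puts
    opposite signs on the two convolutions. The second derivative is bounded uniformly in |x| <= X,
    by a constant that depends on d. *)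
Lemma asym_parts d e psi i : d != 0 -> testf r psi ->
  asym X (fun n => conv d n (eD (ebasis R i) e) psi) (fun n => conv d n e (dpart [:: i] psi)).
Proof.
move=> d0 tp; set b := ebasis R i.
have t1 := testf_dpart [:: i] tp; have t2 := testf_dpart [:: i; i] tp.
have [B0 B00 hB0] := testf_bounded tp.
have [B1 B10 hB1] := testf_bounded t1.
have [B2 B20 hB2] := testf_bounded t2.
pose Q := N%:R * (`|X| + `|r|) ^+ 2 + d ^+ 2.
pose M e' := enorm e' * (Q + 2 + (d ^+ 2)^-1) ^+ edeg e'.
have d2 : 0 < d ^+ 2 by rewrite exprn_even_gt0.
have evM e' x y : `|x| <= X -> `|y| <= r -> `|ev d e' (x - y)| <= M e'.
  move=> xX yr; apply: ev_bound => //; first by rewrite /sq lerDr dot_ge0.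
  rewrite /sq lerD // (le_trans (dot_le_norm_sqr _)) // ler_wpM2l //.
  rewrite lerXn2r ?nnegrE ?addr_ge0 // (le_trans (ler_normB _ _)) // lerD //.
    by rewrite (le_trans xX) // ler_norm.
  by rewrite (le_trans yr) // ler_norm.
have Q0 : 0 <= Q := addr_ge0 (mulr_ge0 (ler0n _ _) (sqr_ge0 _)) (sqr_ge0 _).
have M0 e' : 0 <= M e'.
  apply: mulr_ge0; first exact: enorm_ge0.
  by apply: exprn_ge0; rewrite !addr_ge0 ?invr_ge0 ?sqr_ge0.
pose C := M (eD b (eD b e)) * B0 + 2 * (M (eD b e) * B1) + M e * B2.
have C0 : 0 <= C.
  apply: addr_ge0; last exact: mulr_ge0.
  by apply: addr_ge0; [exact: mulr_ge0|apply: mulr_ge0 => //; exact: mulr_ge0].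
exists ((2 * L%:R) ^+ N * C); split; first by rewrite mulr_ge0 // exprn_ge0 // mulr_ge0.
move=> n x n0 xX.
have sp y : 0 < sq d (x - y) by exact: sq_gt0.
have tT (f : 'rV[R]_N -> R) (tf : testf r f) y : is_derive y b f (dpart [:: i] f y).
  exact: (smooth_onP [::] i (proj1 tf) (I : setT y)).
pose g y := ev d e (x - y) * psi y.
pose g1 y := - ev d (eD b e) (x - y) * psi y + ev d e (x - y) * dpart [:: i] psi y.
pose g2 y := (ev d (eD b (eD b e)) (x - y) * psi y + - ev d (eD b e) (x - y) * dpart [:: i] psi y)
  + (- ev d (eD b e) (x - y) * dpart [:: i] psi y + ev d e (x - y) * dpart [:: i; i] psi y).
have dg y : is_derive y b g (g1 y).
  exact: (is_derive_mul (is_derive_ev_flip e b (sp y)) (tT _ tp y)).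
have dg1 y : is_derive y b g1 (g2 y).
  apply: is_derive_add; apply: is_derive_mul.
  - have h := is_derive_mul (is_derive_cst (-1 : R) y b) (is_derive_ev_flip (eD b e) b (sp y)).
    have -> : (fun y => - ev d (eD b e) (x - y)) = fun y => cst (-1) y * ev d (eD b e) (x - y).
      by apply/funext => z; rewrite mulN1r.
    by apply: (is_derive_eq h); rewrite /cst /=; ring.
  - exact: tT.
  - exact: is_derive_ev_flip.
  - exact: tT.
have g2C y : `|g2 y| <= C.
  have [yr|ry] := leP (`|y|) r; last first.
    rewrite /g2 (proj2 tp) // (proj2 t1) // (proj2 t2) // !mulr0 !addr0 normr0 //.
  have n3 (a1 a2 a3 : R) : `|a1 + a2 + (a2 + a3)| <= `|a1| + 2 * `|a2| + `|a3|.
    rewrite (le_trans (ler_normD _ _)) //.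
    have := ler_normD a1 a2; have := ler_normD a2 a3; lra.
  apply: (le_trans (n3 _ _ _)).
  rewrite !normrM normrN /C !lerD // ?ler_wpM2l // ler_pM // ?evM ?hB0 ?hB1 ?hB2 //.
have g0 y : L%:R <= `|y| -> g y = 0.
  by move=> Ly; rewrite /g (proj2 tp) ?mulr0 // (lt_le_trans rL).
have := lsum_deriv n0 C0 g0 dg dg1 g2C.
rewrite -[_ * C / _]mulrA; apply: le_trans; rewrite distrC /conv -lsumN -lsumD.
by rewrite le_eqVlt; apply/orP; left; apply/eqP; congr `|_|; apply: eq_lsum => y; rewrite /g1; ring.
Qed.

Lemma asym_parts_seq d s e psi : d != 0 -> testf r psi ->
  asym X (fun n => conv d n (eDs s e) psi) (fun n => conv d n e (dpart s psi)).
Proof.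
move=> d0 tp; elim: s e => [|i s IH] e; first exact: asym_refl.
apply: (@asym_trans _ _ (fun n => conv d n (eD (ebasis R i) e) (dpart s psi))); last first.
  exact: (asym_parts e i d0 (testf_dpart s tp)).
apply: asym_eq (IH (eD (ebasis R i) e)) => // n x.
by apply/esym; apply: eqv_conv => //; exact: eqv_eD_eDs.
Qed.

Lemma asym_lap d e psi : d != 0 -> testf r psi ->
  asym X (fun n => conv d n (lap e) psi) (fun n => conv d n e (laplacian psi)).
Proof.
move=> d0 tp.
have h := asym_sum (index_enum 'I_N) (fun i => asym_parts_seq [:: i; i] e d0 tp).
by apply: asym_eq h => n x; rewrite ?/lap ?conv_suml // -conv_sumr.
Qed.

End Convolution.

(** * The approximate identity on the lattice *)

Section KernelSums.
Variable R : realType.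

(** One term of a Riemann sum against the integral of 1 / (u^2 + d^2) over [t - h, t]: there |u - t|
    <= h <= d gives u^2 + d^2 <= 3 (t^2 + d^2). *)
Lemma atan_step (d h t : R) : 0 < d -> 0 < h -> h <= d ->
  h * (t ^+ 2 + d ^+ 2)^-1 <= 3 / d * (atan (t / d) - atan ((t - h) / d)).
Proof.
move=> d0 h0 hd.
have td : (t - h) / d <= t / d by rewrite ler_pM2r ?invr_gt0 //; lra.
have ct : {within `[(t - h) / d, t / d], continuous (@atan R)}.
  by apply: derivable_within_continuous => s _; have [] := is_derive1_atan s.
have [c] := @MVT_segment _ (@atan R) _ _ _ td (fun s _ => is_derive1_atan s) ct.
rewrite in_itv /= => /andP[c1 c2] ->.
pose u := c * d.
have cE : c = u / d by rewrite /u mulfK // gt_eqF.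
have u1 : t - h <= u by move: c1; rewrite ler_pdivrMr.
have u2 : u <= t by move: c2; rewrite ler_pdivlMr.
have p1 : 0 < t ^+ 2 + d ^+ 2 by rewrite ltr_wpDl ?sqr_ge0 // exprn_gt0.
have p2 : 0 < u ^+ 2 + d ^+ 2 by rewrite ltr_wpDl ?sqr_ge0 // exprn_gt0.
have -> : 3 / d * ((1 + c ^+ 2)^-1 * (t / d - (t - h) / d)) = 3 * h / (u ^+ 2 + d ^+ 2).
  rewrite cE expr_div_n; field.
  by rewrite !gt_eqF //= addrC.
rewrite ler_pdivlMr // mulrAC ler_pdivrMr // [3 * h]mulrC -mulrA ler_wpM2l ?(ltW h0) //.
have h1 : (u - t) ^+ 2 <= d ^+ 2 by nra.
have h2 := sqr_ge0 (u - 2 * t); nra.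
Qed.

(** The comparison telescopes, and the range of atan has length pi. *)
Lemma atan_sum (d h a : R) (m : nat) : 0 < d -> 0 < h -> h <= d ->
  h * \sum_(k < m) ((a - k%:R * h) ^+ 2 + d ^+ 2)^-1 <= 3 * pi / d.
Proof.
move=> d0 h0 hd.
pose A k : R := atan ((a - k%:R * h) / d).
apply: (@le_trans _ _ (3 / d * \sum_(k < m) - (A k.+1 - A k))).
  rewrite !big_distrr; apply: ler_sum => k _ /=.
  rewrite opprB /A -[k.+1%:R]natr1 [(_ + 1) * h]mulrDl mul1r opprD addrA; exact: atan_step.
rewrite sumrN -(big_mkord xpredT (fun k => A k.+1 - A k)) telescope_sumr // opprB.
have -> : 3 * pi / d = 3 / d * pi by rewrite mulrAC.
rewrite ler_wpM2l ?divr_ge0 ?(ltW d0) //.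
have := atan_ltpi2 ((a - 0%:R * h) / d); have := atan_gtNpi2 ((a - m%:R * h) / d).
rewrite /A; lra.
Qed.

End KernelSums.

Section ApproximateIdentity.
Variables (R : realType) (N : nat) (HN : N = 2%N \/ N = 3%N) (L : nat).
Implicit Types (d : R) (x y z : 'rV[R]_N) (psi : 'rV[R]_N -> R) (n : nat).

(** For d > 0 this is d^(-N) times a fixed function of x / d, so its integral does not depend on d;
    that integral is not normalized to 1. *)
Definition rho d : expr R N := Kmul (Kcst N (d ^+ 4)) (ipow R N (N + 4)).

Lemma ev_rho d x : ev d (rho d) x = d ^+ 4 * ev d (Kinv R N) x ^+ (N + 4).
Proof. by rewrite /= ev_ipow. Qed.

Lemma Kinv_gt0 d x : 0 < ev d (Kinv R N) x.
Proof. exact: expR_gt0. Qed.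

Lemma Kinv_sqr d x : 0 < d -> ev d (Kinv R N) x ^+ 2 = (sq d x)^-1.
Proof. by move=> d0; rewrite expr2 ev_Inv_sqr // sq_gt0 // gt_eqF. Qed.

Lemma rho_ge0 d x : 0 <= ev d (rho d) x.
Proof.
rewrite ev_rho mulr_ge0 //; last by rewrite exprn_ge0 // ltW // Kinv_gt0.
by rewrite exprn_even_ge0.
Qed.

Lemma mulr_Kinv_le1 d x (a : R) : 0 < d -> 0 <= a -> a ^+ 2 <= sq d x ->
  a * ev d (Kinv R N) x <= 1.
Proof.
move=> d0 a0 h; have F0 := ltW (Kinv_gt0 d x).
rewrite -(@expr_le1 _ 2) // ?mulr_ge0 // exprMn Kinv_sqr //.
by rewrite ler_pdivrMr ?mul1r // sq_gt0 // gt_eqF.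
Qed.

(** A product of one-variable kernels lets the lattice sum factorize. With F = s^(-1/2), each F^2 is
    at most 1 / (x_i^2 + d^2); the factors left over are |x| F <= 1 and, for N = 2, also d F <=
    1. *)
Lemma rho_moment d x : 0 < d ->
  ev d (rho d) x * `|x| <= d ^+ N.+1 * \prod_i (x 0 i ^+ 2 + d ^+ 2)^-1.
Proof.
move=> d0; rewrite ev_rho; set F := ev d _ x.
have F0 : 0 < F by exact: Kinv_gt0.
have dF : d * F <= 1.
  by apply: mulr_Kinv_le1 => //; [exact: ltW|rewrite /sq lerDr dot_ge0].
have xF : `|x| * F <= 1.
  by apply: mulr_Kinv_le1 => //; rewrite /sq (le_trans (norm_sqr_le_dot x)) // lerDl sqr_ge0.
have s0 : 0 < sq d x by rewrite sq_gt0 // gt_eqF.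
have pF : (F ^+ 2) ^+ N <= \prod_i (x 0 i ^+ 2 + d ^+ 2)^-1.
  have -> : (F ^+ 2) ^+ N = \prod_(i < N) F ^+ 2 by rewrite prodr_const card_ord.
  apply: ler_prod => i _; rewrite exprn_ge0 ?(ltW F0) //= Kinv_sqr // lef_pV2 ?posrE //.
    rewrite /sq lerD // /dot (bigD1 i) //= -expr2 lerDl sumr_ge0 // => j _.
    by rewrite -expr2 sqr_ge0.
  by rewrite ltr_wpDl ?sqr_ge0 // exprn_gt0.
apply: (@le_trans _ _ (d ^+ N.+1 * (F ^+ 2) ^+ N)); last first.
  by rewrite ler_wpM2l // exprn_ge0 // ltW.
clear pF; have x0 := normr_ge0 x; have dp := ltW d0.
case: HN => e; subst N.
- have -> : d ^+ 4 * F ^+ (2 + 4) * `|x| = (d ^+ 3 * (F ^+ 2) ^+ 2) * ((d * F) * (`|x| * F)) by ring.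
  rewrite -[X in _ <= X]mulr1 ler_wpM2l ?mulr_ge0 ?exprn_ge0 ?(ltW F0) //.
  by rewrite mulr_ile1 // mulr_ge0 // ltW.
- have -> : d ^+ 4 * F ^+ (3 + 4) * `|x| = (d ^+ 4 * (F ^+ 2) ^+ 3) * (`|x| * F) by ring.
  by rewrite -[X in _ <= X]mulr1 ler_wpM2l ?mulr_ge0 ?exprn_ge0 ?(ltW F0).
Qed.

Lemma lsum_prod n (w : 'I_N -> R -> R) :
  lsum L n (fun y : 'rV[R]_N => \prod_i w i (y 0 i)) =
  \prod_i (n%:R^-1 * \sum_(k < 2 * L * n) w i (k%:R / n%:R - L%:R)).
Proof.
rewrite /lsum big_split /= prodr_const card_ord bigA_distr_bigA /=; congr (_ * _).
by apply: eq_bigr => z _; apply: eq_bigr => i _; rewrite mxE.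
Qed.

(** Each of the N one-dimensional sums is at most 3 pi / d, against the prefactor d^(N+1). *)
Lemma lsum_moment n d x : 0 < d -> (0 < n)%N -> n%:R^-1 <= d ->
  lsum L n (fun y => ev d (rho d) (x - y) * `|x - y|) <= (3 * pi) ^+ N * d.
Proof.
move=> d0 n0 nd.
have np : 0 < n%:R :> R by rewrite ltr0n.
apply: (@le_trans _ _ (lsum L n (fun y : 'rV[R]_N => d ^+ N.+1 *
    \prod_i ((x 0 i - y 0 i) ^+ 2 + d ^+ 2)^-1))).
  apply: ler_lsum => y; apply: (le_trans (rho_moment _ d0)).
  rewrite ler_wpM2l ?exprn_ge0 ?(ltW d0) // le_eqVlt; apply/orP; left; apply/eqP.
  by apply: eq_bigr => i _; rewrite !mxE.
rewrite lsumZ (@lsum_prod n (fun i t => ((x 0 i - t) ^+ 2 + d ^+ 2)^-1)).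
apply: (@le_trans _ _ (d ^+ N.+1 * \prod_(i < N) (3 * pi / d))).
  rewrite ler_wpM2l ?exprn_ge0 ?(ltW d0) //; apply: ler_prod => i _; apply/andP; split.
    rewrite mulr_ge0 ?invr_ge0 ?(ltW np) // sumr_ge0 // => j _.
    by rewrite invr_ge0 addr_ge0 ?sqr_ge0.
  have ni : 0 < n%:R^-1 :> R by rewrite invr_gt0.
  apply: le_trans (@atan_sum _ d n%:R^-1 (x 0 i + L%:R) (2 * L * n) d0 ni nd).
  rewrite ler_wpM2l ?(ltW ni) // le_eqVlt; apply/orP; left; apply/eqP.
  by apply: eq_bigr => j _; rewrite opprB addrA.
rewrite prodr_const card_ord expr_div_n exprS le_eqVlt; apply/orP; left; apply/eqP.
have : d ^+ N != 0 by rewrite expf_neq0 // gt_eqF.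
by move: (d ^+ N) => b b0; field.
Qed.

(** As the mass of [rho] is unknown, psi is compared with psi(x) eta, where eta(x) = 1. The
    difference vanishes at y = x and is Lipschitz in y, so the first moment controls it. *)
Lemma conv_rho_approx r X psi eta : testf r psi -> testf r eta ->
  (forall y, `|y| <= X -> eta y = 1) ->
  exists2 C : R, 0 <= C & forall n d x, 0 < d -> (0 < n)%N -> n%:R^-1 <= d -> `|x| <= X ->
    `|conv L d n (rho d) psi x - psi x * conv L d n (rho d) eta x| <= C * d.
Proof.
move=> tp te eta1.
have [C1 C10 hC1] := testf_lipschitz tp; have [C2 C20 hC2] := testf_lipschitz te.
have [B B0 hB] := testf_bounded tp.
have pi0 : 0 <= pi :> R by exact: pi_ge0.
exists ((C1 + B * C2) * (3 * pi) ^+ N).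
  by rewrite mulr_ge0 ?exprn_ge0 ?mulr_ge0 // addr_ge0 // mulr_ge0.
move=> n d x d0 n0 nd xX.
rewrite /conv -lsumZ -lsumN -lsumD.
apply: (le_trans (ler_norm_lsum _ _ _)).
apply: (@le_trans _ _ (lsum L n (fun y => (C1 + B * C2) * (ev d (rho d) (x - y) * `|x - y|)))).
  apply: ler_lsum => y.
  have -> : ev d (rho d) (x - y) * psi y - psi x * (ev d (rho d) (x - y) * eta y) =
    ev d (rho d) (x - y) * ((psi y - psi x) - psi x * (eta y - eta x)).
    by rewrite (eta1 x xX); ring.
  rewrite normrM (ger0_norm (rho_ge0 _ _)) mulrCA ler_wpM2l ?rho_ge0 //.
  rewrite (le_trans (ler_normB _ _)) // mulrDl lerD //; first by rewrite distrC hC1.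
  by rewrite normrM -mulrA ler_pM // distrC hC2.
by rewrite lsumZ -mulrA ler_wpM2l ?lsum_moment // addr_ge0 // mulr_ge0.
Qed.

(* The gradient in x falls on eta, hence only sees rho at distance at least 1. *)
Lemma conv_rho_flat r X eta : r < L%:R -> testf r eta -> 0 <= X ->
  (forall y, `|y| <= X + 1 -> eta y = 1) ->
  exists2 C : R, 0 <= C & forall d, 0 < d -> exists2 D : R, 0 <= D &
    forall n x, (0 < n)%N -> `|x| <= X ->
    `|conv L d n (rho d) eta x - conv L d n (rho d) eta 0| <= C * d ^+ 4 + D / n%:R.
Proof.
move=> rL te X0 eta1.
have [B hB] : exists B : R, 0 <= B /\ forall i y, `|dpart [:: i] eta y| <= B.
  have /choice[B hB] i : exists B : R, forall y, `|dpart [:: i] eta y| <= B.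
    by have [B _ h] := testf_bounded (testf_dpart [:: i] te); exists B.
  have B0 i : 0 <= B i := le_trans (normr_ge0 _) (hB i 0).
  exists (\sum_i B i); split; first exact: sumr_ge0.
  by move=> i y; apply: (le_trans (hB i y)); rewrite (bigD1 i) //= lerDl sumr_ge0.
have [B0 {}hB] := hB.
exists (N%:R * ((2 * L%:R) ^+ N * B) * X).
  by rewrite !mulr_ge0 // exprn_ge0 // mulr_ge0.
move=> d d0; have dn0 : d != 0 by rewrite gt_eqF.
have [D hD] : exists D : R, 0 <= D /\ forall i n x, (0 < n)%N -> `|x| <= X ->
   `|conv L d n (eD (ebasis R i) (rho d)) eta x - conv L d n (rho d) (dpart [:: i] eta) x| <= D / n%:R.
  have /choice[D hD] i := asym_parts rL X (rho d) i dn0 te.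
  have D0 i : 0 <= D i by have [] := hD i.
  exists (\sum_i D i); split; first exact: sumr_ge0.
  move=> i n x n0 xX; have [_ h] := hD i; apply: (le_trans (h n x n0 xX)).
  by rewrite ler_wpM2r ?invr_ge0 // (bigD1 i) //= lerDl sumr_ge0.
have [D0 {}hD] := hD.
exists (N%:R * D * X); first by rewrite !mulr_ge0.
move=> n x n0 xX.
have tail i z : `|z| <= X ->
    `|conv L d n (rho d) (dpart [:: i] eta) z| <= (2 * L%:R) ^+ N * (B * d ^+ 4).
  move=> zX; apply: lsum_bound => // y.
  have [yX|yX] := ltP (`|y|) (X + 1).
    have -> : dpart [:: i] eta y = 0.
      rewrite -[RHS](@dpart_cst0 R N [:: i] y) /=.
      have oB : open [set y : 'rV[R]_N | `|y| < X + 1].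
        have -> : [set y : 'rV[R]_N | `|y| < X + 1] = (fun y => `|y|) @^-1` [set t | t < X + 1] by [].
        by apply: open_comp; [move=> w _; exact: norm_continuous|exact: open_lt].
      have -> : 'D_(ebasis R i) (fun=> 0 : R) y = 'D_(ebasis R i) (fun=> 1 : R) y.
        by rewrite !derive_cst.
      by apply: (@dpart_near _ _ _ eta (fun=> 1) [:: i] oB) => // w /ltW; exact: eta1.
    by rewrite mulr0 normr0 mulr_ge0 // exprn_ge0 // ltW.
  (* Here |z - y| >= 1, so [Kinv] is at most 1 and the kernel at most d^4. *)
  rewrite normrM [X in X <= _]mulrC ler_pM //.
  rewrite ger0_norm ?rho_ge0 // ev_rho ler_piMr ?exprn_ge0 ?(ltW d0) //.
  apply: exprn_ile1; first exact: ltW (Kinv_gt0 _ _).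
  rewrite -[X in X <= _]mul1r; apply: mulr_Kinv_le1 => //.
  rewrite expr1n /sq (le_trans _ (lerD (norm_sqr_le_dot _) (sqr_ge0 d))) // addr0.
  have h : 1 <= `|z - y| by have := ler_normD (y - z) z; rewrite subrK distrC; lra.
  by rewrite exprn_ege1.
have dconv w i : is_derive w (ebasis R i) (conv L d n (rho d) eta) (conv L d n (eD (ebasis R i) (rho d)) eta w).
  rewrite /conv /lsum.
  have h : is_derive w (ebasis R i)
     (fun x => \sum_(z : lattice N L n) ev d (rho d) (x - lpt R z) * eta (lpt R z))
     (\sum_(z : lattice N L n) ev d (eD (ebasis R i) (rho d)) (w - lpt R z) * eta (lpt R z)).
    apply: (@is_derive_fsum R 'rV[R]_N _ _
      (fun (z : lattice N L n) (x : 'rV[R]_N) => ev d (rho d) (x - lpt R z) * eta (lpt R z))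
      (fun (z : lattice N L n) (w : 'rV[R]_N) => ev d (eD (ebasis R i) (rho d)) (w - lpt R z) * eta (lpt R z))) => z.
    have := is_derive_mul (is_derive_ev_shift (rho d) (ebasis R i) (z := lpt R z) (x := w) (sq_gt0 _ dn0))
      (is_derive_cst (eta (lpt R z)) w (ebasis R i)).
    by rewrite mulr0 addr0.
  have := is_derive_mul (is_derive_cst (n%:R^-1 ^+ N : R) w (ebasis R i)) h.
  by rewrite mul0r add0r.
pose C := (2 * L%:R) ^+ N * (B * d ^+ 4) + D / n%:R.
have := @lipschitz_box R N (conv L d n (rho d) eta)
  (fun i w => conv L d n (eD (ebasis R i) (rho d)) eta w) C X (fun w _ i => dconv w i) _ 0 x.
rewrite normr0 subr0 => h; apply: (le_trans (h _ X0 xX)).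
  move=> w wX i; rewrite -(subrK (conv L d n (rho d) (dpart [:: i] eta) w) (conv L d n (eD _ _) _ _)).
  by rewrite (le_trans (ler_normD _ _)) // addrC lerD ?tail // hD.
have C0 : 0 <= C.
  rewrite /C; apply: addr_ge0; last by rewrite mulr_ge0 // invr_ge0.
  apply: mulr_ge0; first by rewrite exprn_ge0 // mulr_ge0.
  by apply: mulr_ge0 => //; rewrite exprn_ge0 // ltW.
apply: (@le_trans _ _ (N%:R * C * X)); first by rewrite ler_wpM2l // mulr_ge0.
by rewrite /C le_eqVlt; apply/orP; left; apply/eqP; ring.
Qed.

(** With d = 1/p and n = p q, the cube [0, d)^N has q^N lattice points, on which s <= (N + 1) d^2
    and hence [Kinv] >= 1 / ((N + 1) d). All powers of d and q cancel. *)
Lemma conv_rho_ge eta (p q : nat) : (0 < L)%N -> (0 < p)%N -> (0 < q)%N ->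
  (forall y, 0 <= eta y) -> (forall y, `|y| <= 1 -> eta y = 1) ->
  (N%:R + 1)^-1 ^+ (N + 4) <= conv L p%:R^-1 (p * q) (rho p%:R^-1) eta 0 :> R.
Proof.
move=> L0 p0 q0 eta0 eta1; set n := (p * q)%N; set d := p%:R^-1.
have pp : 0 < p%:R :> R by rewrite ltr0n.
have qp : 0 < q%:R :> R by rewrite ltr0n.
have Np : 0 < N%:R + 1 :> R by rewrite ltr_wpDl.
have d0 : 0 < d by rewrite invr_gt0.
have d1 : d <= 1 by rewrite invf_le1 // ler1n.
have nE : n%:R = p%:R * q%:R :> R by rewrite natrM.
have np : 0 < n%:R :> R by rewrite nE mulr_gt0.
pose w (t : R) : R := if (0 <= t) && (t < d) then 1 else 0.
pose c : R := (N%:R + 1)^-1 ^+ (N + 4).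
have c0 : 0 < c by rewrite exprn_gt0 // invr_gt0.
apply: (@le_trans _ _ (lsum L n (fun y : 'rV[R]_N => (c * d^-1 ^+ N) * \prod_i w (y 0 i)))); last first.
  apply: ler_lsum => y.
  have [hy|hy] := boolP [forall i, (0 <= y 0 i) && (y 0 i < d)]; last first.
    move: hy; rewrite negb_forall => /existsP[i /negbTE wi].
    have -> : \prod_i w (y 0 i) = 0 by rewrite (bigD1 i) //= /w wi mul0r.
    by rewrite mulr0 mulr_ge0 // rho_ge0.
  have hi i := forallP hy i.
  have -> : \prod_i w (y 0 i) = 1 by rewrite big1 // => i _; rewrite /w hi.
  have yd : `|y| <= d.
    apply: norm_le_coord; first exact: ltW.
    by move=> i; have /andP[a b] := hi i; rewrite ger0_norm // ltW.
  rewrite mulr1 eta1 ?(le_trans yd) // mulr1 sub0r ev_rho.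
  set F := ev d _ _.
  have F0 : 0 < F by exact: Kinv_gt0.
  have Fge : ((N%:R + 1) * d)^-1 <= F.
    rewrite -(@ler_pXn2r _ 2) ?nnegrE ?invr_ge0 ?mulr_ge0 ?(ltW d0) ?(ltW Np) ?(ltW F0) //.
    rewrite Kinv_sqr // exprVn lef_pV2 ?posrE ?exprn_gt0 ?mulr_gt0 ?sq_gt0 ?gt_eqF //.
    rewrite /sq dotNl dotC dotNl opprK.
    have h1 := dot_le_norm_sqr y.
    have h2 : `|y| ^+ 2 <= d ^+ 2 by rewrite lerXn2r ?nnegrE // ltW.
    have h3 := ler_wpM2l (ler0n R N) h2.
    have h4 : 0 <= d ^+ 2 by rewrite sqr_ge0.
    rewrite exprMn; have := ler0n R N; nra.
  have -> : c * d^-1 ^+ N = d ^+ 4 * ((N%:R + 1) * d)^-1 ^+ (N + 4).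
    rewrite /c invfM exprMn [d^-1 ^+ (N + 4)]exprD [d^-1 ^+ 4]exprVn.
    by rewrite mulrCA [d ^+ 4 * _]mulrCA mulfV ?mulr1 // expf_neq0 // gt_eqF.
  rewrite ler_wpM2l ?exprn_ge0 ?(ltW d0) // lerXn2r ?nnegrE ?(ltW F0) //.
  by rewrite invr_ge0 mulr_ge0 ?(ltW d0) ?(ltW Np).
rewrite lsumZ (@lsum_prod n (fun=> w)) prodr_const card_ord -mulrA -/c.
rewrite -exprMn ler_peMr ?(ltW c0) // exprn_ege1 //.
(* Index L n is the coordinate 0, and the q indices from there on fill [0, d), because q / n = d. *)
have key : q%:R <= \sum_(k < 2 * L * n) w (k%:R / n%:R - L%:R).
  rewrite -(big_mkord xpredT (fun k => w (k%:R / n%:R - L%:R))).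
  have l1 : (L * n <= 2 * L * n)%N by rewrite leq_mul2r leq_pmull ?orbT.
  have l2 : (L * n + q <= 2 * L * n)%N.
    rewrite -mulnA mul2n -addnn leq_add2l /n -[q in (q <= _)%N]mul1n mulnA leq_mul2r.
    by rewrite muln_gt0 L0 p0 orbT.
  rewrite (big_cat_nat (leq0n (L * n + q)) l2) /= (big_cat_nat (leq0n (L * n)) (leq_addr q _)) /=.
  have w0 t : 0 <= w t by rewrite /w; case: ifP.
  have -> : q%:R = \sum_(L * n <= k < L * n + q) w (k%:R / n%:R - L%:R).
    rewrite big_nat_cond (eq_bigr (fun=> 1)); last first.
      move=> k /andP[/andP[k1 k2] _]; rewrite /w subr_ge0 ler_pdivlMr // -natrM ler_nat k1 /=.
      rewrite ltrBlDr ltr_pdivrMr // mulrDl -natrM -/n /d nE mulrA mulVf ?gt_eqF // mul1r.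
      by rewrite -natrD ltr_nat addnC k2.
    by rewrite -big_nat_cond big_const_nat addKn iter_addr addr0.
  rewrite -addrA addrCA lerDl addr_ge0 // sumr_ge0 //.
have E : 1 = d^-1 * (n%:R^-1 * q%:R) :> R.
  by rewrite /d nE invrK; field; rewrite !gt_eqF.
by rewrite [X in X <= _]E ler_wpM2l ?invr_ge0 ?(ltW d0) // ler_wpM2l ?invr_ge0 ?(ltW np).
Qed.

End ApproximateIdentity.

(** * Representation of Stokes fields by kernels *)

Section StokesKernels.
Variables (R : realType) (N : nat) (Phi : expr R N) (c : R).
Hypothesis hPhi : forall d x, 0 < sq d x ->
  ev d (lap (lap Phi)) x = c * d ^+ 4 * ev d (Kinv R N) x ^+ (N + 4).
Implicit Types (d : R) (x y : 'rV[R]_N) (e : expr R N) (i j : 'I_N) (n : nat).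

Local Notation eb i := (ebasis R i).

(* Columns of the fundamental solution of the Stokes system, up to the factor c. *)
Definition stokeslet i j : expr R N :=
  Kadd (Kmul (Kcst N (i == j)%:R) (lap Phi)) (Kmul (Kcst N (-1)) (eD (eb i) (eD (eb j) Phi))).

(** Up to a factor, the velocity of a point source of mass: a gradient of a function harmonic off
    the pole, with zero pressure. It accounts for the divergence created by the cut-off. *)
Definition source j : expr R N := eD (eb j) (lap Phi).

Lemma eqv_lap_eD2 d i j e : eqv d (lap (eD (eb i) (eD (eb j) e))) (eD (eb i) (eD (eb j) (lap e))).
Proof.
move=> x s0; rewrite -(eqv_eD_lap _ _ s0); apply: eqv_eD s0 => y sy.
by rewrite -(eqv_eD_lap _ _ sy).
Qed.

Lemma lap2_0 x : 0 < sq 0 x -> ev 0 (lap (lap Phi)) x = 0.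
Proof. by move=> s0; rewrite hPhi // expr0n mulr0 mul0r. Qed.

Lemma sum_delta j (F : 'I_N -> R) : \sum_i (i == j)%:R * F i = F j.
Proof.
rewrite (bigD1 j) //= eqxx mul1r big1 ?addr0 // => i /negbTE ->.
by rewrite mul0r.
Qed.

Lemma ev_eD_stokeslet d v i j x : ev d (eD v (stokeslet i j)) x =
  (i == j)%:R * ev d (eD v (lap Phi)) x - ev d (eD v (eD (eb i) (eD (eb j) Phi))) x.
Proof. by rewrite [LHS]/= !mul0r !add0r mulN1r. Qed.

(** The sum is d_j lap Phi - lap d_j Phi, which is 0 for every d; this is what removes the pressure
    exactly in the regularized representation. *)
Lemma div_stokeslet d j x : 0 < sq d x ->
  \sum_i ev d (eD (eb i) (stokeslet i j)) x = 0.
Proof.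
move=> s0; rewrite (eq_bigr _ (fun i _ => ev_eD_stokeslet d (eb i) i j x)) sumrB.
rewrite (sum_delta j (fun i => ev d (eD (eb i) (lap Phi)) x)).
by rewrite (eqv_eD_lap _ _ s0) /lap ev_sume subrr.
Qed.

(** Only the momentum equation uses d = 0, through lap^2 Phi = 0; the pressure - d_i lap Phi absorbs
    the term that remains. *)
Lemma stokes_stokeslet i :
  stokes_expr (stokeslet i) (Kmul (Kcst N (-1)) (eD (eb i) (lap Phi))).
Proof.
split=> [j x s0|x s0].
- rewrite ev_eDZ ev_lapD !ev_lapZ lap2_0 // mulr0 add0r (eqv_lap_eD2 _ _ _ s0).
  by rewrite ev_eD_comm; ring.
- rewrite -[RHS](div_stokeslet i s0); apply: eq_bigr => j _.
  rewrite !ev_eD_stokeslet eq_sym; congr (_ - _).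
  by apply: eqv_eD s0 => y _; rewrite ev_eD_comm.
Qed.

Lemma stokes_source : stokes_expr source (Kcst N 0).
Proof.
have h0 : eqv 0 (lap (lap Phi)) (Kcst N 0) by move=> y sy; rewrite lap2_0.
split=> [j x s0|x s0].
- by rewrite /source -(eqv_eD_lap _ _ s0) (eqv_eD _ h0 s0) /= oppr0 addr0.
- by rewrite -[RHS](lap2_0 s0) [in RHS]/lap ev_sume.
Qed.

Lemma ev_eDsD d s e1 e2 x : ev d (eDs s (Kadd e1 e2)) x = ev d (eDs s e1) x + ev d (eDs s e2) x.
Proof.
have -> : eDs s (Kadd e1 e2) = Kadd (eDs s e1) (eDs s e2) by elim: s => //= i s ->.
by [].
Qed.

Lemma eqv_eDsZ d s (a : R) e : eqv d (eDs s (Kmul (Kcst N a) e)) (Kmul (Kcst N a) (eDs s e)).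
Proof.
elim: s => // i s IH x s0.
by rewrite [LHS](eqv_eD (eb i) IH s0) ev_eDZ.
Qed.

Lemma eqv_eDs_lap d s e : eqv d (eDs s (lap e)) (lap (eDs s e)).
Proof.
elim: s => // i s IH x s0.
by rewrite [LHS](eqv_eD (eb i) IH s0) (eqv_eD_lap _ _ s0).
Qed.

Lemma eDs_sume s (I : Type) (r : seq I) (F : I -> expr R N) d x :
  ev d (eDs s (sume r F)) x = \sum_(a <- r) ev d (eDs s (F a)) x.
Proof.
have -> : eDs s (sume r F) = sume r (fun a => eDs s (F a)).
  by elim: s => [|i s IH] //=; rewrite IH eD_sume.
exact: ev_sume.
Qed.

Lemma ev_eDs_cst0 d s x : ev d (eDs s (Kcst N 0)) x = 0.
Proof.
have -> : eDs s (Kcst N (0 : R)) = Kcst N 0 by elim: s => //= i s ->.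
by [].
Qed.

Variables (L : nat) (r X : R) (rL : r < L%:R).
Variables (U : 'I_N -> 'rV[R]_N -> R) (P : 'rV[R]_N -> R).
Hypotheses (tU : forall j, testf r (U j)) (tP : testf r P).

Definition force i y : R := - laplacian (U i) y + dpart [:: i] P y.
Definition flux y : R := \sum_i dpart [:: i] (U i) y.

Lemma testf_force i : testf r (force i).
Proof.
have tl := testf_sum (index_enum 'I_N) (fun l => testf_dpart [:: l; l] (tU i)).
exact: (testfD (testfN tl) (testf_dpart [:: i] tP)).
Qed.

Lemma testf_flux : testf r flux.
Proof. exact: (testf_sum (index_enum 'I_N) (fun l => testf_dpart [:: l] (tU l))). Qed.

(** Discrete representation formula for U_j in terms of its defects. All derivatives fall on the
    kernels, so at d = 0 it is a finite combination of jets. *)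
Definition potential d n (s : seq 'I_N) j x : R :=
  \sum_i - conv L d n (eDs s (stokeslet i j)) (force i) x
  + conv L d n (eDs s (source j)) flux x.

(** Let S_ij be the stokeslet. Moving derivatives to the kernels turns the force terms into lap S_ij
    against U_i, minus d_i S_ij against P. The P terms add up to 0 by [div_stokeslet], and lap S_ij
    + d_i source_j = (i == j) lap^2 Phi. *)
Lemma asym_potential d s j : d != 0 ->
  asym X (fun n => potential d n s j)
         (fun n => conv L d n (lap (lap Phi)) (dpart s (U j))).
Proof.
move=> d0; pose e i := eDs s (stokeslet i j); pose E := eDs s (source j).
have sp x : 0 < sq d x by exact: sq_gt0.
have A i : asym X (fun n x => - conv L d n (e i) (force i) x)
    (fun n x => conv L d n (lap (e i)) (U i) x + - conv L d n (eD (eb i) (e i)) P x).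
  have h := asymD (asym_sym (asym_lap rL X (e i) d0 (tU i)))
    (asymN (asym_sym (asym_parts rL X (e i) i d0 tP))).
  apply: asym_eq h => // n x.
  by rewrite convDr convNr opprD opprK.
have B : asym X (fun n => conv L d n E flux) (fun n x => \sum_i conv L d n (eD (eb i) E) (U i) x).
  have h := asym_sum (index_enum 'I_N) (fun i => asym_sym (asym_parts rL X E i d0 (tU i))).
  by apply: asym_eq h => // n x; rewrite conv_sumr.
apply: (asym_trans (asymD (asym_sum (index_enum 'I_N) A) B)).
apply: asym_eq (asym_parts_seq rL X s (lap (lap Phi)) d0 (tU j)) => // n x.
rewrite big_split /= sumrN.
have -> : \sum_i conv L d n (eD (eb i) (e i)) P x = 0.
  rewrite -conv_suml (@eqv_conv _ _ _ _ _ _ (Kcst N 0)) //.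
    by rewrite /conv /lsum big1 ?mulr0 // => z _; rewrite /= mul0r.
  move=> y sy; rewrite ev_sume.
  have -> : ev d (Kcst N 0) y = ev d (eDs s (Kcst N 0)) y by rewrite ev_eDs_cst0.
  rewrite -(@eqv_eDs _ _ d s (sume (index_enum 'I_N) (fun i => eD (eb i) (stokeslet i j))) _ _ y sy).
    by rewrite eDs_sume; apply: eq_bigr => i _; exact: eqv_eD_eDs.
  by move=> z sz; rewrite ev_sume div_stokeslet.
rewrite subr0 -big_split /=.
rewrite -[LHS](sum_delta j (fun i => conv L d n (eDs s (lap (lap Phi))) (U i) x)).
apply: eq_bigr => i _; rewrite -convDl -convZl; apply: eqv_conv => // y sy.
rewrite -(eqv_eDsZ _ _ _ sy).
have -> : ev d (Kadd (lap (e i)) (eD (eb i) E)) y =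
    ev d (eDs s (Kadd (lap (stokeslet i j)) (eD (eb i) (source j)))) y.
  by rewrite ev_eDsD (eqv_eDs_lap _ _ sy) -(eqv_eD_eDs _ _ _ sy).
apply: eqv_eDs sy => z sz; rewrite ev_scale.
rewrite -[RHS]/(ev d (lap (stokeslet i j)) z + ev d (eD (eb i) (source j)) z).
rewrite /stokeslet ev_lapD !ev_lapZ /source.
rewrite (eqv_lap_eD2 _ _ _ sz) mulN1r.
by rewrite addrNK.
Qed.

Variables (K W : set 'rV[R]_N) (delta : R).
Hypotheses (KX : forall x, K x -> `|x| <= X) (delta0 : 0 < delta).
Hypothesis far : forall x y, K x -> ~ W y -> delta <= `|x - y|.
Hypotheses (force0 : forall i y, W y -> force i y = 0) (flux0 : forall y, W y -> flux y = 0).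

(** Only poles outside W contribute. They keep a distance delta from K, where the two kernels differ
    by O(d^2); for lattice points in W the weight 0 also hides the default value of the singular
    kernel. *)
Lemma conv_cvg0 e psi : testf r psi -> (forall y, W y -> psi y = 0) ->
  exists2 C : R, 0 <= C & forall d n x, 0 < d <= 1 -> (0 < n)%N -> K x ->
    `|conv L 0 n e psi x - conv L d n e psi x| <= C * d.
Proof.
move=> tp p0; have [B B0 hB] := testf_bounded tp.
pose Q := N%:R * (`|X| + `|r|) ^+ 2.
have d20 : 0 < delta ^+ 2 by rewrite exprn_gt0.
have [C C0 hC] := ev_cvg0 e Q d20.
exists ((2 * L%:R) ^+ N * (C * B)).
  apply: mulr_ge0; [|exact: mulr_ge0]; by rewrite exprn_ge0 // mulr_ge0.
move=> d n x /andP[d0 d1] n0 Kx; rewrite -mulrA /conv -lsumN -lsumD.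
apply: lsum_bound => // y.
have Cd : 0 <= C * B * d by rewrite !mulr_ge0 // ltW.
have [Wy|nWy] := pselect (W y).
  by rewrite p0 // !mulr0 subr0 normr0.
have [yr|ry] := leP (`|y|) r; last first.
  by rewrite (proj2 tp) // !mulr0 subr0 normr0.
rewrite -mulrBl normrM mulrAC ler_pM // distrC.
apply: (le_trans (hC d (x - y) _ _ _)).
- by rewrite ger0_norm // ltW.
- by apply: le_trans (norm_sqr_le_dot _); rewrite lerXn2r ?nnegrE ?far // ltW.
- apply: (le_trans (dot_le_norm_sqr _)); rewrite ler_wpM2l // lerXn2r ?nnegrE ?addr_ge0 //.
  rewrite (le_trans (ler_normB _ _)) // lerD //.
    by rewrite (le_trans (KX Kx)) // ler_norm.
  by rewrite (le_trans yr) // ler_norm.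
- by rewrite ler_wpM2l // expr2 ler_piMl // ltW.
Qed.

Lemma potential_cvg0 s j : exists2 C : R, 0 <= C & forall d n x, 0 < d <= 1 -> (0 < n)%N -> K x ->
  `|potential 0 n s j x - potential d n s j x| <= C * d.
Proof.
have [C1 C10 h1] : exists2 C : R, 0 <= C & forall i d n x, 0 < d <= 1 -> (0 < n)%N -> K x ->
   `|conv L 0 n (eDs s (stokeslet i j)) (force i) x -
     conv L d n (eDs s (stokeslet i j)) (force i) x| <= C * d.
  have /choice[C hC] i : exists C : R, 0 <= C /\ forall d n x, 0 < d <= 1 -> (0 < n)%N -> K x ->
   `|conv L 0 n (eDs s (stokeslet i j)) (force i) x -
     conv L d n (eDs s (stokeslet i j)) (force i) x| <= C * d.
    have [C C0 h] := conv_cvg0 (eDs s (stokeslet i j)) (testf_force i) (force0 i).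
    by exists C.
  have C0 i : 0 <= C i by have [] := hC i.
  exists (\sum_i C i) => [|i d n x d01 n0 Kx]; first exact: sumr_ge0.
  have [_ h] := hC i; apply: (le_trans (h d n x d01 n0 Kx)).
  have /andP[d0 _] := d01.
  by rewrite ler_wpM2r ?(ltW d0) // (bigD1 i) //= lerDl sumr_ge0.
have [C2 C20 h2] := conv_cvg0 (eDs s (source j)) testf_flux flux0.
exists (N%:R * C1 + C2) => [|d n x d01 n0 Kx]; first by rewrite addr_ge0 // mulr_ge0.
rewrite /potential opprD addrACA -sumrB mulrDl (le_trans (ler_normD _ _)) // lerD ?h2 //.
apply: (le_trans (ler_norm_sum _ _ _)).
apply: (@le_trans _ _ (\sum_(i < N) C1 * d)); last first.
  by rewrite sumr_const card_ord -mulrA mulr_natl.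
by apply: ler_sum => i _; rewrite -opprD normrN h1.
Qed.

Variables (HN : N = 2%N \/ N = 3%N) (eta : 'rV[R]_N -> R).
Hypotheses (teta : testf r eta) (eta1 : forall y, `|y| <= X + 1 -> eta y = 1).

(** A is chosen before d and D after it, so that d can be fixed before the mesh is refined. *)
Lemma potential_approx s j : 0 <= X -> exists2 A : R, 0 <= A & forall d, 0 < d <= 1 ->
  exists2 D : R, 0 <= D & forall n x, (0 < n)%N -> n%:R^-1 <= d -> K x ->
  `|potential 0 n s j x - c * conv L d n (rho N d) eta 0 * dpart s (U j) x| <= A * d + D / n%:R.
Proof.
move=> X0; set psi := dpart s (U j).
have tpsi : testf r psi by exact: testf_dpart.
have [B B0 hB] := testf_bounded tpsi.
have [A1 A10 h1] := potential_cvg0 s j.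
have e1 y : `|y| <= X -> eta y = 1 by move=> yX; rewrite eta1 // (le_trans yX) // lerDl.
have [A2 A20 h2] := conv_rho_approx HN L tpsi teta e1.
have [A3 A30 h3] := conv_rho_flat rL teta X0 eta1.
have c0 := normr_ge0 c.
exists (A1 + `|c| * A2 + `|c| * B * A3) => [|d d01].
  by rewrite !addr_ge0 // !mulr_ge0.
have /andP[d0 d1] := d01; have dn0 : d != 0 by rewrite gt_eqF.
have [D1 [D10 k1]] := asym_potential s j dn0.
have [D2 D20 k2] := h3 d d0.
exists (D1 + `|c| * B * D2) => [|n x n0 nd Kx].
  by rewrite addr_ge0 // !mulr_ge0.
have E : conv L d n (lap (lap Phi)) psi x = c * conv L d n (rho N d) psi x.
  rewrite -convZl; apply: eqv_conv => // y sy.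
  by rewrite hPhi // [RHS]/= ev_ipow mulrA.
have a1 := h1 d n x d01 n0 Kx.
have a2 := k1 n x n0 (KX Kx); rewrite E in a2.
have a3 := h2 n d x d0 n0 nd (KX Kx).
have a4 := k2 n x n0 (KX Kx).
set p0 := potential 0 n s j x in a1 *; set pd := potential d n s j x in a1 a2.
set v := conv L d n (rho N d) psi x in a2 a3.
set mx := conv L d n (rho N d) eta x in a3 a4; set m0 := conv L d n (rho N d) eta 0 in a4 *.
(* Errors of the regularization, of the summation by parts and of the approximate identity; the last
   term replaces the mass seen from x by the one seen from 0, a constant one can divide by. *)
have -> : p0 - c * m0 * psi x = (p0 - pd) + (pd - c * v) + (c * (v - psi x * mx) + c * psi x * (mx - m0)).
  by ring.
have b3 : `|c * (v - psi x * mx)| <= `|c| * A2 * d by rewrite normrM -mulrA ler_wpM2l.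
have b4 : `|c * psi x * (mx - m0)| <= `|c| * B * (A3 * d + D2 / n%:R).
  rewrite !normrM ler_pM ?mulr_ge0 // ?ler_wpM2l // (le_trans a4) // lerD2r ler_wpM2l //.
  by rewrite exprS ler_piMr ?(ltW d0) // exprn_ile1 // ltW.
apply: (le_trans (ler_normD _ _)); apply: (le_trans (lerD (ler_normD _ _) (ler_normD _ _))).
apply: (le_trans (lerD (lerD a1 a2) (lerD b3 b4))).
by rewrite le_eqVlt; apply/orP; left; apply/eqP; ring.
Qed.

Lemma approximable_potential (k : nat) (Omega : set 'rV[R]_N) (n : nat) (a : R) :
  open Omega -> (forall y, ~ K y -> good_pole k K Omega y) -> K `<=` W ->
  approximable k K Omega (fun s j x => a * potential 0 n s j x).
Proof.
move=> oO good KW.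
have piece E Q psi : stokes_expr E Q -> (forall y, W y -> psi y = 0) ->
    approximable k K Omega (fun s j x => conv L 0 n (eDs s (E j)) psi x).
  move=> sE p0.
  have h := @approximable_sum R N k K Omega _ (index_enum (lattice N L n))
    (fun z => n%:R^-1 ^+ N * psi (lpt R z)) (fun z => jet E (lpt R z)) oO.
  apply: approximable_ext (h _).
    move=> s j x _; rewrite /conv /lsum big_distrr; apply: eq_bigr => z _ /=.
    by rewrite /jet -mulrA; congr (_ * _); rewrite mulrC.
  move=> z; have [Kz|nK] := pselect (K (lpt R z)).
    by right; rewrite p0 ?mulr0 //; exact: KW.
  by left; exact: good sE.
have h := @approximable_sum R N k K Omega _ (index_enum 'I_N) (fun=> -1)
  (fun i s j x => conv L 0 n (eDs s (stokeslet i j)) (force i) x) oO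
  (fun i => or_introl (piece _ _ _ (stokes_stokeslet i) (force0 i))).
have h2 := approximable_add 1 oO h (piece _ _ _ stokes_source flux0).
apply: approximable_ext (approximable_add a oO (@approximable0 R N k K Omega) h2) => s j x _.
rewrite add0r /potential mul1r; congr (_ * (_ + _)).
by apply: eq_bigr => i _; rewrite mulN1r.
Qed.

Lemma approximable_field (k : nat) (Omega : set 'rV[R]_N) : c != 0 -> (0 < L)%N -> 0 <= X ->
  (forall y, 0 <= eta y) ->
  open Omega -> (forall y, ~ K y -> good_pole k K Omega y) -> K `<=` W ->
  approximable k K Omega (fun s j x => dpart s (U j) x).
Proof.
move=> cn0 L0 X0 eta0 oO good KW; apply: approximable_lim => eps eps0.
have c0 : 0 < `|c| by rewrite normr_gt0.
pose kap : R := (N%:R + 1)^-1 ^+ (N + 4).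
have kap0 : 0 < kap by rewrite exprn_gt0 // invr_gt0 ltr_wpDl.
(* Two error terms share eps, and |c| kap bounds from below the modulus of the divisor c m. *)
pose tol := eps * (`|c| * kap) / 2.
have tol0 : 0 < tol by rewrite divr_gt0 // !mulr_gt0.
have inv_small (A : R) : 0 <= A -> exists2 p : nat, (0 < p)%N & A / p%:R <= tol.
  move=> A0; exists (Num.bound (A / tol)).+1 => //.
  rewrite ler_pdivrMr ?ltr0n // mulrC -ler_pdivrMr // ltW //.
  apply: (lt_le_trans (archi_boundP _)); first by rewrite divr_ge0 // ltW.
  by rewrite ler_nat.
have /choice[A hA] sj : exists A : R, 0 <= A /\ forall d, 0 < d <= 1 ->
    exists D : R, 0 <= D /\ forall n x, (0 < n)%N -> n%:R^-1 <= d -> K x ->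
  `|potential 0 n sj.1 sj.2 x - c * conv L d n (rho N d) eta 0 * dpart sj.1 (U sj.2) x| <= A * d + D / n%:R.
  have [A A0 h] := potential_approx sj.1 sj.2 X0.
  by exists A; split=> // d /h[D D0 hD]; exists D.
have [A' A'0 hA'] := bounded_words k (fun s j => A (s, j)).
have [p p0 hp] := inv_small A' A'0.
have pp : 0 < p%:R :> R by rewrite ltr0n.
pose d : R := p%:R^-1.
have d01 : 0 < d <= 1 by rewrite invr_gt0 pp invf_le1 // ler1n.
have /choice[D hD] sj : exists D : R, 0 <= D /\ forall n x, (0 < n)%N -> n%:R^-1 <= d -> K x ->
  `|potential 0 n sj.1 sj.2 x - c * conv L d n (rho N d) eta 0 * dpart sj.1 (U sj.2) x| <= A sj * d + D / n%:R.
  by have [_ /(_ d d01)] := hA sj.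
have [D' D'0 hD'] := bounded_words k (fun s j => D (s, j)).
have [q q0 hq] := inv_small D' D'0.
have qp : 0 < q%:R :> R by rewrite ltr0n.
(* A multiple of p, as [conv_rho_ge] requires; n >= p makes the mesh at most d, and n >= q makes D'
   / n at most [tol]. *)
pose n := (p * q)%N; have n0 : (0 < n)%N by rewrite muln_gt0 p0.
have np : 0 < n%:R :> R by rewrite ltr0n.
pose m := conv L d n (rho N d) eta 0.
have mge : kap <= m.
  apply: conv_rho_ge => // y y1; apply: eta1; rewrite (le_trans y1) // lerDr //.
have m0 : 0 < m by exact: lt_le_trans mge.
exists (fun s j x => (c * m)^-1 * potential 0 n s j x); first exact: approximable_potential.
move=> s sk j x Kx; have [_ /(_ n x n0 _ Kx)/= h] := hD (s, j).
have cm0 : c * m != 0 by rewrite mulf_neq0 // gt_eqF.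
have -> : (c * m)^-1 * potential 0 n s j x - dpart s (U j) x =
    (c * m)^-1 * (potential 0 n s j x - c * m * dpart s (U j) x).
  by rewrite mulrBr mulKf.
rewrite normrM normfV ler_pdivrMl ?normr_gt0 //.
apply: (le_trans (h _)).
  by rewrite lef_pV2 ?posrE // ler_nat leq_pmulr.
apply: (@le_trans _ _ (tol + tol)); last first.
  rewrite /tol -splitr normrM (ger0_norm (ltW m0)) mulrC ler_wpM2r ?(ltW eps0) //.
  by rewrite ler_wpM2l.
apply: lerD.
  by apply: le_trans hp; rewrite ler_wpM2r ?invr_ge0 ?(ltW pp) // hA'.
apply: (le_trans _ hq); rewrite ler_pM ?invr_ge0 ?hD' //.
- by have [] := hD (s, j).
- by rewrite lef_pV2 ?posrE // ler_nat leq_pmull.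
Qed.

End StokesKernels.

(** * Margins, supports and conclusion *)

Lemma compact_margin (R : realType) (N : nat) (K W : set 'rV[R]_N) :
  compact K -> open W -> K `<=` W ->
  exists2 delta : R, 0 < delta & forall x y, K x -> ~ W y -> delta <= `|x - y|.
Proof.
move=> /compact_near_coveringP cK oW KW.
pose P (t : R) (x : 'rV[R]_N) := forall y, `|x - y| < t -> W y.
have /cK : forall x, K x -> \forall x' \near x & t \near (0 : R)^'+, P t x'.
  move=> x /KW Wx; have /nbhs_ballP[e /= e0 he] : nbhs x W by exact: open_nbhs_nbhs.
  have e2 : 0 < e / 2 by rewrite divr_gt0.
  exists (ball x (e / 2), [set t | t < e / 2]).
    split; first exact: nbhsx_ballx.
    by apply: nbhs_right_lt.
  move=> [x' t] [/= xx' te] y x'y; apply: he; rewrite -ball_normE /= in xx' *.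
  by rewrite (le_lt_trans (ler_distD x' _ _)) // [e]splitr ltrD // (lt_trans x'y).
move=> h.
have [delta [d0 hd]] : exists t : R, 0 < t /\ K `<=` P t.
  near (0 : R)^'+ => t; exists t; split; first by near: t; exact: nbhs_right_gt.
  by near: t; exact: h.
exists delta => // x y Kx nW; rewrite leNgt; apply/negP => xy; apply: nW.
exact: hd Kx y xy.
Unshelve. all: by end_near. Qed.

Lemma bounded_closure_compact (R : realType) (N : nat) (A : set 'rV[R]_N) (r : R) :
  (forall x, A x -> `|x| <= r) -> compact (closure A).
Proof.
move=> h; apply: bounded_closed_compact; last exact: closed_closure.
exists r; split; first exact: num_real.
move=> M rM x cx; apply: le_trans (ltW rM).
have cl : closed [set y : 'rV[R]_N | `|y| <= r].
  have -> : [set y : 'rV[R]_N | `|y| <= r] = (fun y => `|y|) @^-1` [set t | t <= r] by [].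
  by apply: closed_comp; [move=> y _; exact: norm_continuous|exact: closed_le].
have hA : A `<=` [set y | `|y| <= r] by [].
by have := closure_subset hA cx; rewrite -((closure_id _).1 cl).
Qed.

(** V and the complement of C are open and cover the space; the product is smooth on the first and
    identically 0 on the second, whatever f is outside V. *)
Lemma testf_cutoff (R : realType) (N : nat) (V C : set 'rV[R]_N) (chi f : 'rV[R]_N -> R) (r : R) :
  open V -> closed C -> C `<=` V -> (forall x, V x -> `|x| <= r) ->
  smooth_on setT chi -> (forall x, ~ C x -> chi x = 0) -> smooth_on V f ->
  testf r (fun x => chi x * f x).
Proof.
move=> oV cC CV Vr schi chi0 sf; split; last first.
  move=> y ry; rewrite chi0 ?mul0r // => /CV /Vr; by rewrite leNgt ry.
apply: (@smooth_on_sub _ _ (V `|` ~` C)).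
  by move=> x _; have [/CV|] := pselect (C x); [left|right].
apply: smooth_on_cup.
  by apply: (smooth_onM oV _ sf); exact: smooth_on_sub schi.
have oC : open (~` C) by exact: closed_openC.
by apply: (smooth_on_near oC _ (smooth_on_cst 0 oC)) => x /chi0 ->; rewrite mul0r.
Qed.

Lemma testf_le (R : realType) (N : nat) (psi : 'rV[R]_N -> R) (r r' : R) :
  r <= r' -> testf r psi -> testf r' psi.
Proof. by move=> rr [s h]; split=> // y ry; apply: h; exact: le_lt_trans ry. Qed.

Theorem theorem2 (R : realType) (N : nat) (HN : N = 2%N \/ N = 3%N)
  (K V Omega : set 'rV[R]_N)
  (hK : compact K) (hVo : open V) (hVb : bounded_set V)
  (hOo : open Omega) (hOb : bounded_set Omega)
  (hKV : K `<=` V) (hVO : closure V `<=` Omega)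
  (hcomp : forall x, (~` K) x ->
     exists y, connected_component (~` K) x y /\ interior (~` Omega) y)
  (u : 'rV[R]_N -> 'rV[R]_N) (p : 'rV[R]_N -> R)
  (hsm : smooth_pair_on V u p) (hst : stokes_on V u p)
  (k : nat) (eps : R) (heps : 0 < eps) :
  exists (ub : 'rV[R]_N -> 'rV[R]_N) (pb : 'rV[R]_N -> R),
    smooth_pair_on setT ub pb /\
    compact (closure [set x | ub x != 0 \/ pb x != 0]) /\
    stokes_on Omega ub pb /\
    Ck_le k K (fun x => ub x - u x) eps.
Proof.
have KO : K `<=` Omega by move=> x /hKV /subset_closure /hVO.
have oT := @openT 'rV[R]_N.
have [su sp] := hsm; have [mom dv] := hst.
suff : approximable k K Omega (fun s j => dpart s (fun y => u y 0 j)).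
  move=> /(_ eps heps)[ub [pb [[sub spb] [r hr] stb close]]].
  exists ub, pb; split=> //; split; last split=> //.
    apply: (@bounded_closure_compact _ _ _ r) => x /= h; rewrite leNgt; apply/negP => rx.
    by have [u0 p0] := hr x rx; case: h; rewrite ?u0 ?p0 eqxx.
  move=> s sk j x Kx; have subV := smooth_on_sub (@subsetT _ V) (sub j).
  have -> : (fun y => (ub y - u y) 0 j) = fun y => ub y 0 j + - u y 0 j.
    by apply/funext => y; rewrite !mxE.
  rewrite (dpartD s hVo subV (smooth_onN hVo (su j)) (hKV x Kx)).
  by rewrite (dpartN s hVo (su j) (hKV x Kx)); exact: close.
have good y : ~ K y -> good_pole k K Omega y by exact: good_pole_all.
have [Phi [c [c0 hPhi]]] := biharmonic_kernel R HN.
have [X X0 KX] := bounded_set_norm (compact_bounded hK).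
have [r1 r10 Vr1] := bounded_set_norm hVb.
have [chi [W0 [C [schi [oW0 cC] [KW0 CV] chi1 chi0]]]] := cutoff_compact hK hVo hKV.
(* On W both the cut-off is 1 and the Stokes system holds, so the defects vanish there. *)
pose W := W0 `&` V.
have oW : open W by exact: openI.
have KW : K `<=` W by move=> x Kx; split; [exact: KW0|exact: hKV].
have [delta delta0 far] := compact_margin hK oW KW.
have n0 : 0 < 2 * (N%:R + 1) :> R by have := ler0n R N; lra.
have X1 : 0 < X + 1 by lra.
(* The outer radius for which [bump_ball] gives the value 1 up to X + 1. *)
pose r2 := (X + 1) * (2 * (N%:R + 1)).
have [eta [seta eta0 eta1 etaz]] := @bump_ball R N 0 r2 (mulr_gt0 X1 n0).
pose r := Num.max r1 r2.
have r1r : r1 <= r by rewrite le_max lexx.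
have r2r : r2 <= r by rewrite le_max lexx orbT.
have rp : 0 <= r by exact: le_trans r1r.
(* The successor ensures 0 < L, which the lower bound on the mass requires. *)
pose L := (Num.bound r).+1.
have rL : r < L%:R.
  by apply: (lt_le_trans (archi_boundP rp)); rewrite ler_nat.
pose U j x := chi x * u x 0 j; pose P x := chi x * p x.
have tU j : testf r (U j).
  exact: (testf_le r1r (testf_cutoff hVo cC CV Vr1 schi chi0 (su j))).
have tP : testf r P.
  exact: (testf_le r1r (testf_cutoff hVo cC CV Vr1 schi chi0 sp)).
have UE j s x : W x -> dpart s (U j) x = dpart s (fun y => u y 0 j) x.
  by move=> Wx; apply: (dpart_near s oW) => // y [W0y _]; rewrite /U chi1 // mul1r.
have PE s x : W x -> dpart s P x = dpart s p x.
  by move=> Wx; apply: (dpart_near s oW) => // y [W0y _]; rewrite /P chi1 // mul1r.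
have teta : testf r eta.
  by apply: (testf_le r2r); split=> // y ry; apply: etaz; rewrite subr0 ltW.
have eta1' y : `|y| <= X + 1 -> eta y = 1.
  by move=> yX; apply: eta1; rewrite subr0 mulfK // gt_eqF.
have force0 i y : W y -> force U P i y = 0.
  move=> Wy; have h := mom y (proj2 Wy) i.
  have E : laplacian (U i) y = laplacian (fun z => u z 0 i) y.
    by apply: eq_bigr => l _; exact: UE.
  by rewrite /force E (PE [:: i] y Wy).
have flux0 y : W y -> flux U y = 0.
  by move=> Wy; rewrite -[RHS](dv y (proj2 Wy)); apply: eq_bigr => l _; exact: UE.
have := @approximable_field R N Phi c hPhi L r X rL U P tU tP K W delta KX delta0 far
  force0 flux0 HN eta teta eta1' k Omega c0 (ltn0Sn _) X0 eta0 hOo good KW.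
by apply: approximable_ext => s j x Kx; apply: UE; exact: KW.
Qed.
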